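(* Let $k\in\{\mathbb{R},\mathbb{C}\}$ be fixed. The category $\mathsf{LB}$ of countable Hausdorff locally convex inductive limits of Banach spaces over $k$, furnished with linear and continuous maps as morphisms, is left quasi-abelian but neither right semi-abelian nor left integral.
   Context: An object of $\mathsf{LB}$ is a Hausdorff locally convex space that is the locally convex inductive limit (i.e. carries the finest locally convex topology making all canonical maps from the steps continuous) of a sequence of Banach spaces with continuous linear linking maps. An additive category is pre-abelian if every morphism has a kernel and a cokernel. A morphism is called ''a kernel'' (resp. ''a cokernel'') if it is the kernel (resp. cokernel) of some morphism. A pre-abelian category is right semi-abelian if every morphism $f$ can be written as $f=i\circ p$ with $i$ a kernel and $p$ an epimorphism. A class $\mathcal{X}$ of morphisms is stable under pullback if in any pullback square with $a\colon A\to B$, $b\colon A\to C$, $c\colon B\to D$, $d\colon C\to D$ and $c\circ a=d\circ b$, one has $a\in\mathcal{X}$ whenever $d\in\mathcal{X}$. A pre-abelian category is left quasi-abelian if cokernels are stable under pullback, and left integral if epimorphisms are stable under pullback. *)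

(* Defs.v *)
From HB Require Import structures.
From mathcomp Require Import all_boot all_order all_algebra.
From mathcomp Require Import all_classical all_reals all_analysis.
From mathcomp Require Import complex.

Set Implicit Arguments.
Unset Strict Implicit.
Unset Printing Implicit Defensive.

Import Order.TTheory GRing.Theory Num.Theory.
Import numFieldNormedType.Exports.
Local Open Scope classical_set_scope.
Local Open Scope ring_scope.

Record preadditive := Preadditive {
  obj :> Type;
  mor : obj -> obj -> zmodType;
  idmor : forall A, mor A A;
  mcomp : forall A B C, mor B C -> mor A B -> mor A C;
  comp1m : forall A B (f : mor A B), mcomp (idmor B) f = f;
  compm1 : forall A B (f : mor A B), mcomp f (idmor A) = f;
  compA : forall A B C D (f : mor C D) (g : mor B C) (h : mor A B),
    mcomp f (mcomp g h) = mcomp (mcomp f g) h;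
  compDl : forall A B C (f f' : mor B C) (g : mor A B),
    mcomp (f + f') g = mcomp f g + mcomp f' g;
  compDr : forall A B C (f : mor B C) (g g' : mor A B),
    mcomp f (g + g') = mcomp f g + mcomp f g'
}.

Arguments idmor {p} A.
Arguments mcomp {p A B C} f g.

Declare Scope cat_scope.
Delimit Scope cat_scope with cat.
Notation "f \o g" := (mcomp f g) : cat_scope.

Section Category.
Local Open Scope cat_scope.
Variable C : preadditive.
Implicit Types A B D Z : C.

Definition zero_object Z :=
  forall A, (exists! f : mor A Z, True) /\ (exists! f : mor Z A, True).

Definition biproduct A B P (iA : mor A P) (iB : mor B P)
    (pA : mor P A) (pB : mor P B) :=
  [/\ pA \o iA = idmor A, pB \o iB = idmor B, pA \o iB = 0, pB \o iA = 0
    & (iA \o pA) + (iB \o pB) = idmor P].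

Definition additive_category :=
  (exists Z, zero_object Z) /\
  (forall A B, exists P iA iB pA pB, @biproduct A B P iA iB pA pB).

Definition kernel_of A B K (f : mor A B) (i : mor K A) :=
  f \o i = 0 /\
  forall X (g : mor X A), f \o g = 0 -> exists! h : mor X K, i \o h = g.

Definition cokernel_of A B Q (f : mor A B) (p : mor B Q) :=
  p \o f = 0 /\
  forall X (g : mor B X), g \o f = 0 -> exists! h : mor Q X, h \o p = g.

Definition is_kernel K A (i : mor K A) :=
  exists B (f : mor A B), kernel_of f i.

Definition is_cokernel B Q (p : mor B Q) :=
  exists A (f : mor A B), cokernel_of f p.

Definition epimorphism A B (p : mor A B) :=
  forall X (g h : mor B X), g \o p = h \o p -> g = h.

Definition pre_abelian :=
  additive_category /\
  forall A B (f : mor A B),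
    (exists K (i : mor K A), kernel_of f i) /\
    (exists Q (p : mor B Q), cokernel_of f p).

Definition pullback_square A B E D (a : mor A B) (b : mor A E)
    (c : mor B D) (d : mor E D) :=
  c \o a = d \o b /\
  forall X (x : mor X B) (y : mor X E), c \o x = d \o y ->
    exists! h : mor X A, a \o h = x /\ b \o h = y.

Definition stable_under_pullback (X : forall A B, mor A B -> Prop) :=
  forall A B E D (a : mor A B) (b : mor A E) (c : mor B D) (d : mor E D),
    pullback_square a b c d -> X E D d -> X A B a.

Definition right_semi_abelian :=
  pre_abelian /\
  forall A B (f : mor A B),
    exists I (i : mor I B) (p : mor A I),
      [/\ f = i \o p, is_kernel i & epimorphism p].

Definition left_quasi_abelian :=
  pre_abelian /\ stable_under_pullback is_cokernel.

Definition left_integral :=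
  pre_abelian /\ stable_under_pullback epimorphism.

End Category.

Section LinearContinuous.
Variables (k : numFieldType) (E F : tvsType k).

Definition lcfun_pred : {pred E -> F} :=
  [pred f | `[< linear f /\ continuous f >]].

Lemma lcfun_pred_zmod_closed : zmod_closed lcfun_pred.
Proof.
split.
  apply/asboolP; split; first by move=> a x y; rewrite /= scaler0 addr0.
  exact: cst_continuous.
move=> f g /asboolP[fl fc] /asboolP[gl gc]; apply/asboolP; split.
  move=> a x y; rewrite !fctE fl gl scalerBr opprD.
  by rewrite !addrA; congr (_ + _); rewrite addrAC.
move=> x; apply: (@continuous_comp _ _ _ (fun x => (f x, - g x))
  (fun z : F * F => z.1 + z.2)); last exact: add_continuous.
apply: cvg_pair; first exact: fc.
apply: (@continuous_comp _ _ _ g -%R); [exact: gc|exact: opp_continuous].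
Qed.

HB.instance Definition _ :=
  GRing.isZmodClosed.Build (E -> F) lcfun_pred
    lcfun_pred_zmod_closed.

Record lcfun := LCFun {
  lcfun_fun :> E -> F;
  lcfunP : lcfun_fun \in lcfun_pred
}.

HB.instance Definition _ := [isSub for lcfun_fun].
HB.instance Definition _ := [Choice of lcfun by <:].
HB.instance Definition _ := [SubChoice_isSubZmodule of lcfun by <:].

Lemma lcfun_linear (f : lcfun) : linear f.
Proof. by case: f => f /= /asboolP[]. Qed.

Lemma lcfun_continuous (f : lcfun) : continuous f.
Proof. by case: f => f /= /asboolP[]. Qed.

HB.instance Definition _ (f : lcfun) :=
  GRing.isLinear.Build k E F *:%R f (lcfun_linear f).

End LinearContinuous.

Lemma lcfun_id_subproof (k : numFieldType) (E : tvsType k) :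
  (@id E) \in @lcfun_pred k E E.
Proof. by apply/asboolP; split=> // x; apply: cvg_id. Qed.

Definition lcfun_id (k : numFieldType) (E : tvsType k) : lcfun E E :=
  LCFun (lcfun_id_subproof E).

Lemma lcfun_comp_subproof (k : numFieldType) (E F G : tvsType k)
  (f : lcfun F G) (g : lcfun E F) : (f \o g) \in @lcfun_pred k E G.
Proof.
apply/asboolP; split; first by move=> a x y; rewrite /= !linearP.
by move=> x; apply: continuous_comp; exact: lcfun_continuous.
Qed.

Definition lcfun_comp (k : numFieldType) (E F G : tvsType k)
    (f : lcfun F G) (g : lcfun E F) : lcfun E G :=
  LCFun (lcfun_comp_subproof f g).

Section InductiveLimit.
Variables (k : numFieldType) (S : nat -> tvsType k).
Variable u : forall n, lcfun (S n) (S n.+1).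

Fixpoint lc_link (n m : nat) : S n -> S (m + n) :=
  match m return S n -> S (m + n) with
  | 0 => id
  | m'.+1 => fun x => u (m' + n) (lc_link m' x)
  end.

(* [E] with the maps [j n] is the colimit of the [S n] in vector spaces *)
Definition algebraic_inductive_limit (E : lmodType k)
    (j : forall n, {linear S n -> E}) :=
  [/\ forall n x, j n.+1 (u n x) = j n x,
      forall y : E, exists n x, j n x = y
    & forall n x, j n x = 0 -> exists m, lc_link m x = 0].

(* A competing locally convex topology on the vector space [E] is given as a
   locally convex space [F] together with a linear bijection [phi : E -> F]
   along which the topology is transported; it is coarser than that of [E]
   exactly when [phi] is continuous. *)
Definition finest_lc_topology (E : tvsType k)
    (j : forall n, {linear S n -> E}) :=
  (forall n, continuous (j n)) /\
  forall (F : tvsType k) (phi : {linear E -> F}), bijective phi ->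
    (forall n, continuous (phi \o j n)) -> continuous phi.

Definition lc_inductive_limit (E : tvsType k)
    (j : forall n, {linear S n -> E}) :=
  algebraic_inductive_limit j /\ finest_lc_topology j.

End InductiveLimit.

Definition is_LB (k : numFieldType) (E : tvsType k) :=
  hausdorff_space E /\
  exists (S : nat -> completeNormedModType k)
         (u : forall n, lcfun (S n) (S n.+1))
         (j : forall n, {linear S n -> E}),
    @lc_inductive_limit k S u E j.

(* [tvsType] is locally convex by definition; of its uniform structure only
   the underlying topology is used, here and in the morphisms. *)
Record LBspace (k : numFieldType) := {
  LB_tvs :> tvsType k;
  LB_isLB : is_LB LB_tvs
}.

Section LBcategory.
Variable k : numFieldType.

Lemma LB_comp1m (A B : LBspace k) (f : lcfun A B) :
  lcfun_comp (lcfun_id B) f = f.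
Proof. exact: val_inj. Qed.

Lemma LB_compm1 (A B : LBspace k) (f : lcfun A B) :
  lcfun_comp f (lcfun_id A) = f.
Proof. exact: val_inj. Qed.

Lemma LB_compA (A B C D : LBspace k)
  (f : lcfun C D) (g : lcfun B C) (h : lcfun A B) :
  lcfun_comp f (lcfun_comp g h) = lcfun_comp (lcfun_comp f g) h.
Proof. exact: val_inj. Qed.

Lemma LB_compDl (A B C : LBspace k) (f f' : lcfun B C) (g : lcfun A B) :
  lcfun_comp (f + f') g = lcfun_comp f g + lcfun_comp f' g.
Proof. exact: val_inj. Qed.

Lemma LB_compDr (A B C : LBspace k) (f : lcfun B C) (g g' : lcfun A B) :
  lcfun_comp f (g + g') = lcfun_comp f g + lcfun_comp f g'.
Proof. by apply: val_inj; apply/funext => x; rewrite /= linearD. Qed.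

Definition LB : preadditive :=
  @Preadditive (LBspace k) (fun A B => lcfun A B : zmodType)
    (fun A => lcfun_id A) (fun A B C f g => lcfun_comp f g)
    LB_comp1m LB_compm1 LB_compA LB_compDl LB_compDr.

End LBcategory.

(* Main.v *)
From HB Require Import structures.
Require Import Defs.
From mathcomp Require Import all_boot all_order all_algebra.
From mathcomp Require Import all_classical all_reals all_analysis.
From mathcomp Require Import complex lra ring.

(* Every LB-space carries the finest locally convex topology making a nested
   covering sequence of maps from Banach spaces continuous. By Baire's theorem, a
   continuous linear map from a Banach space whose image is covered by these steps
   lifts, with a norm bound, to a single step. Hence kernels (with the finest
   topology of the kernels on the steps) have the universal property, and a
   continuous surjection of LB-spaces is the cokernel of its kernel. Cokernels
   are therefore exactly the surjections, and these are stable under pullback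
   because points of an LB-space are morphisms from the scalar field.

   The diagonal operator T = diag(2^-i) of l^1 has dense range, so it is an
   epimorphism. Pulled back along a line that meets this range only in 0, it
   becomes the map 0 -> k, which is not one: LB is not left integral.

   For right semi-abelianity, let F be the direct sum of countably many copies of
   l^1, embedded in l^1 by splitting the coordinates into infinite blocks
   ("levels"), and let phi x be the sum of level(i) x_i. The map j = (inclusion, T)
   from F to l^1 + F is a kernel, of (x, y) |-> T x - y. Any factorization of j
   restricted to ker phi as a kernel of some g after an epimorphism gives g o j
   vanishing on ker phi, so g (j x) = phi x * w for a fixed vector w. Evaluating at
   unit vectors e_i of level n, as i grows and then n, gives w = 0. So j factors
   through that kernel, and phi would vanish on F. *)

Set Implicit Arguments.
Unset Strict Implicit.
Unset Printing Implicit Defensive.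

Import Order.TTheory GRing.Theory Num.Theory.
Import numFieldNormedType.Exports.
Local Open Scope classical_set_scope.
Local Open Scope ring_scope.

(** * Geometric rates of convergence *)

Section Geometric.
Variable R : realType.

Definition geo (n : nat) : R := 2^-1 ^+ n.

Lemma geo_gt0 n : 0 < geo n.
Proof. by rewrite exprn_gt0// invr_gt0. Qed.

Lemma geo_ge0 n : 0 <= geo n.
Proof. exact/ltW/geo_gt0. Qed.

Lemma geoS n : geo n.+1 = geo n / 2.
Proof. by rewrite /geo exprSr. Qed.

Lemma geo0 : geo 0 = 1. Proof. by rewrite /geo expr0. Qed.

Lemma geo_le1 n : geo n <= 1.
Proof. by rewrite exprn_ile1 ?invr_ge0// invf_le1// ler1n. Qed.

Lemma geo_small (M e : R) : 0 < e -> exists n, forall m, (n <= m)%N -> M * geo m < e.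
Proof.
move=> e0; have : (fun n => geo n) @ \oo --> (0 : R).
  by apply: cvg_expr; rewrite ger0_norm ?invr_ge0// invf_lt1// ltr1n.
have d0 : 0 < e / (`|M| + 1) by rewrite divr_gt0// ltr_wpDl.
move=> /cvgrPdist_lt /(_ _ d0)[n _ hn]; exists n => m nm.
have := hn m nm; rewrite /= sub0r normrN gtr0_norm ?geo_gt0//.
rewrite ltr_pdivlMr ?ltr_wpDl// => h; apply: le_lt_trans h.
rewrite mulrC ler_wpM2l ?geo_ge0//.
by rewrite (le_trans (ler_norm M))// lerDl.
Qed.

Lemma le_geo (a b M : R) : (forall n, a <= b + M * geo n) -> a <= b.
Proof.
move=> h; apply/ler_addgt0Pr => e e0; have [n hn] := geo_small M e0.
by apply: le_trans (h n) _; rewrite lerD2l ltW// hn.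
Qed.

End Geometric.
Arguments geo {R} n.

(* The scalar field is either R or C; [remb] and [rabs] translate between its
   nonnegative elements, where norms live, and the reals. *)
Record rscalars (R : realType) (k : numFieldType) := RScalars {
  remb : {rmorphism R -> k};
  rabs : k -> R;
  rembK : forall a, remb (rabs a) = `|a|;
  remb_le : forall x y, (remb x <= remb y) = (x <= y);
  rabs_complete : forall (u : nat -> k) (C : R),
    (forall n, rabs (u n.+1 - u n) <= C * geo n) ->
    exists l M, forall n, rabs (l - u n) <= M * geo n
}.

(** * Real-valued absolute values on the scalars, and Banach norms *)

Section Scalars.
Variables (R : realType) (k : numFieldType) (rs : rscalars R k).
Local Notation emb := (remb rs).
Local Notation abs := (rabs rs).

Lemma remb_inj : injective emb.
Proof. exact: fmorph_inj. Qed.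

Lemma remb_lt x y : (emb x < emb y) = (x < y).
Proof. by rewrite !lt_neqAle remb_le (inj_eq remb_inj). Qed.

Lemma rabs_emb x : 0 <= x -> abs (emb x) = x.
Proof.
move=> x0; apply: remb_inj; rewrite rembK ger0_norm//.
by rewrite -(rmorph0 emb) remb_le.
Qed.

Lemma rabs_ge0 a : 0 <= abs a.
Proof. by rewrite -(remb_le rs) rmorph0 rembK. Qed.

Lemma rabsM a b : abs (a * b) = abs a * abs b.
Proof. by apply: remb_inj; rewrite rmorphM !rembK normrM. Qed.

Lemma rabsD a b : abs (a + b) <= abs a + abs b.
Proof. by rewrite -(remb_le rs) rmorphD !rembK ler_normD. Qed.

Lemma rabs_eq0 a : abs a = 0 -> a = 0.
Proof. by move=> h; apply/normr0_eq0; rewrite -(rembK rs) h rmorph0. Qed.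

Lemma rabs0 : abs 0 = 0.
Proof. by apply: remb_inj; rewrite rembK normr0 rmorph0. Qed.

Lemma rabs1 : abs 1 = 1.
Proof. by apply: remb_inj; rewrite rembK normr1 rmorph1. Qed.

Lemma rabsN a : abs (- a) = abs a.
Proof. by apply: remb_inj; rewrite !rembK normrN. Qed.

Lemma rabsV a : abs a^-1 = (abs a)^-1.
Proof. by apply: remb_inj; rewrite fmorphV !rembK normfV. Qed.

Lemma rabs_nat n : abs n%:R = n%:R.
Proof. by apply: remb_inj; rewrite rembK rmorph_nat ger0_norm. Qed.

Lemma rabs_norm a : abs `|a| = abs a.
Proof. by apply: remb_inj; rewrite !rembK normr_id. Qed.

Lemma rabs_gt0 e : 0 < e -> 0 < abs e.
Proof. by move=> e0; rewrite -remb_lt rmorph0 rembK gtr0_norm. Qed.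

Lemma rabs_pos a : a != 0 -> 0 < abs a.
Proof.
move=> a0; rewrite lt_neqAle rabs_ge0 andbT eq_sym.
by apply: contra_neq a0 => /rabs_eq0.
Qed.

Lemma remb_pos e : 0 < e -> emb (abs e) = e.
Proof. by move=> e0; rewrite rembK gtr0_norm. Qed.

(** Completeness is asked only of sequences with geometric increments, the limit coming with a rate.
    This avoids fixing a topology on [V] and loses nothing, since Cauchy filters yield such
    sequences ([T_complete]). *)
Record banach (V : lmodType k) (N : V -> R) : Prop := Banach {
  normB_D : forall x y, N (x + y) <= N x + N y;
  normB_Z : forall a x, N (a *: x) = abs a * N x;
  normB_eq0 : forall x, N x = 0 -> x = 0;
  normB_complete : forall (u : nat -> V) (C : R),
    (forall n, N (u n.+1 - u n) <= C * geo n) ->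
    exists l M, forall n, N (l - u n) <= M * geo n
}.

Section BanachTheory.
Variables (V : lmodType k) (N : V -> R) (bN : banach N).

Lemma normB0 : N 0 = 0.
Proof. by rewrite -(scale0r 0) (normB_Z bN) rabs0 mul0r. Qed.

Lemma normB_N x : N (- x) = N x.
Proof. by rewrite -scaleN1r (normB_Z bN) rabsN rabs1 mul1r. Qed.

Lemma normB_ge0 x : 0 <= N x.
Proof.
have := normB_D bN x (- x); rewrite subrr normB0 normB_N.
by rewrite -mulr2n pmulrn_lge0.
Qed.

Lemma normB_B x y : N (x - y) = N (y - x).
Proof. by rewrite -normB_N opprB. Qed.

Lemma normB_tri z x y : N (x - y) <= N (x - z) + N (z - y).
Proof. by rewrite -[x - y](subrKA z) (le_trans (normB_D bN _ _)). Qed.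

(** Telescoping bounds the distance from [u 0] to [u n] by a geometric series; the unknown rate [M]
    disappears as n grows, leaving a bound in [C] alone. *)
Lemma normB_fast_bound (u : nat -> V) C l M :
  (forall n, N (u n.+1 - u n) <= C * geo n) ->
  (forall n, N (l - u n) <= M * geo n) -> N (l - u 0) <= 2 * C.
Proof.
move=> hu hl; apply: (@le_geo _ _ _ M) => n.
apply: le_trans (normB_tri (u n) _ _) _; rewrite addrC lerD//.
suff : N (u n - u 0) <= 2 * C - 2 * C * geo n.
  move=> /le_trans; apply; rewrite gerBl mulr_ge0 ?geo_ge0// mulr_ge0//.
  by have := le_trans (normB_ge0 _) (hu 0%N); rewrite geo0 mulr1.
elim: n => [|n IH]; first by rewrite subrr normB0 geo0 mulr1 subrr.
apply: le_trans (normB_tri (u n) _ _) _.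
by have := hu n; rewrite geoS; lra.
Qed.

(** An alias of [V] that remembers [bN], on which the normed-space instances are declared. *)
Definition bnT of banach N : Type := V.

End BanachTheory.

Section BanachType.
Variables (V : lmodType k) (N : V -> R) (bN : banach N).
Local Notation T := (@bnT V N bN).
HB.instance Definition _ := GRing.Lmodule.on T.

Let nrm (x : T) : k := emb (N x).

Let nrmD x y : nrm (x + y) <= nrm x + nrm y.
Proof. by rewrite /nrm -rmorphD remb_le; exact: (normB_D bN). Qed.

Let nrmZ (l : k) (x : T) : nrm (l *: x) = `|l| * nrm x.
Proof. by rewrite /nrm -(rembK rs) -rmorphM; congr (emb _); exact: (normB_Z bN). Qed.

Let nrm0 (x : T) : nrm x = 0 -> x = 0.
Proof.
by move=> h; apply: (normB_eq0 bN); apply: remb_inj; rewrite rmorph0.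
Qed.

HB.instance Definition _ := Lmodule_isNormed.Build k T nrmD nrmZ nrm0.

Lemma bnT_norm (x : T) : `|x| = emb (N x).
Proof. by []. Qed.

Let T_complete (F : set_system T) : ProperFilter F -> cauchy F -> cvg F.
Proof.
move=> FF /cauchyP Fc.
(* Balls of radius [geo n] belonging to the filter pairwise meet, so their centres have geometric
   increments. *)
have ex n : exists x : T, F (ball x (emb (geo n))).
  by apply: Fc; rewrite -(rmorph0 emb) remb_lt geo_gt0.
have [u hu] := choice ex.
have hd n m : N ((u n : V) - u m) <= geo n + geo m.
  have : (ball (u n) (emb (geo n)) `&` ball (u m) (emb (geo m))) !=set0.
    exact: (filter_ex (filterI (hu n) (hu m))).
  move=> [x []]; rewrite -!ball_normE /= !bnT_norm !remb_lt => h1 h2.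
  apply: le_trans (normB_tri bN (x : V) _ _) _.
  by rewrite lerD ?ltW// (normB_B bN).
have [|l [M hl]] := normB_complete bN (u := u) (C := 2).
  move=> n; apply: le_trans (hd _ _) _; rewrite geoS.
  by have := geo_gt0 R n; lra.
apply/cvg_ex; exists (l : T); apply/cvg_ballP => e e0.
have [n hn] := geo_small (M + 1) (rabs_gt0 e0).
apply: filterS (hu n) => x; rewrite -!ball_normE /= !bnT_norm -(remb_pos e0).
rewrite !remb_lt => h; apply: le_lt_trans (normB_tri bN (u n : V) _ _) _.
by apply: le_lt_trans (hn n (leqnn _)); rewrite mulrDl mul1r lerD// ltW.
Qed.

HB.instance Definition _ := Uniform_isComplete.Build T T_complete.

End BanachType.

(** Geometric increments make a sequence Cauchy, and the tail of the geometric series is a rate for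
    its limit. *)
Lemma banach_complete (S : completeNormedModType k) :
  banach (fun x : S => abs `|x|).
Proof.
split.
- by move=> x y; rewrite -(remb_le rs) rmorphD !rembK !normr_id ler_normD.
- by move=> a x; rewrite normrZ rabsM rabs_norm.
- by move=> x /rabs_eq0 /normr0_eq0.
move=> u C hu.
have C0 : 0 <= C.
  by have := le_trans (rabs_ge0 _) (hu 0%N); rewrite geo0 mulr1.
have tri (x y z : S) : abs `|x - y| <= abs `|x - z| + abs `|z - y|.
  by rewrite -(remb_le rs) rmorphD !rembK !normr_id ler_distD.
have hd n m : abs `|u (m + n)%N - u n| <= (2 * C) * geo n - (2 * C) * geo (m + n).
  elim: m => [|m IH]; first by rewrite add0n !subrr normr0 rabs0.
  rewrite addSn; apply: le_trans (tri _ _ (u (m + n)%N)) _.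
  by have := hu (m + n)%N; rewrite geoS; lra.
have hd' n m : (n <= m)%N -> abs `|u n - u m| <= (2 * C) * geo n.
  move=> nm; rewrite distrC -(subnK nm); apply: le_trans (hd _ _) _.
  by rewrite gerBl !mulr_ge0// geo_ge0.
have : cauchy (u @ \oo).
  apply/cauchyP => e e0.
  have [n hn] := geo_small (2 * C) (rabs_gt0 e0); exists (u n).
  exists n => // m /= nm; rewrite -ball_normE /= -(remb_pos e0).
  rewrite -[ltLHS]normr_id -(rembK rs) remb_lt.
  exact: le_lt_trans (hd' _ _ nm) (hn n _).
move=> /cauchy_cvg/cvg_ex[l /cvgrPdist_lt hl]; exists l, (2 * C) => n.
apply/ler_addgt0Pr => e e0.
have e0' : 0 < emb e by rewrite -(rmorph0 emb) remb_lt.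
have [m0 _ hm] := hl _ e0'.
have := hm (maxn m0 n) (leq_maxl _ _).
rewrite -[ltLHS]normr_id -(rembK rs) remb_lt => h.
apply: le_trans (tri _ _ (u (maxn m0 n))) _; rewrite addrC lerD ?(ltW h)//.
by rewrite distrC hd' ?leq_maxr.
Qed.

End Scalars.

(** * Absolutely convex neighbourhoods of zero *)

Section AbsolutelyConvex.
Variable k : numFieldType.

Definition absconvex (E : lmodType k) (W : set E) :=
  (forall (c : k) x, `|c| <= 1 -> W x -> W (c *: x)) /\
  (forall (t : k) x y, 0 <= t <= 1 -> W x -> W y -> W (t *: x + (1 - t) *: y)).

Lemma absconvex_half (E : lmodType k) (W : set E) x y :
  absconvex W -> W x -> W y -> W (2^-1 *: (x + y)).
Proof.
move=> [_ /(_ 2^-1 x y) + Wx Wy]; rewrite scalerDr.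
have -> : 1 - 2^-1 = 2^-1 :> k by rewrite {1}(splitr 1) mul1r addrK.
by apply; rewrite // invr_ge0 invf_le1// ler1n ler0n.
Qed.

Lemma absconvexI (E : lmodType k) (W V : set E) :
  absconvex W -> absconvex V -> absconvex (W `&` V).
Proof.
move=> [W1 W2] [V1 V2]; split=> [c x c1 [Wx Vx]|t x y t1 [Wx Vx] [Wy Vy]].
  by split; [exact: W1|exact: V1].
by split; [exact: W2|exact: V2].
Qed.

Lemma absconvex_preimage (E F : lmodType k) (f : E -> F) (W : set F) :
  linear f -> absconvex W -> absconvex (f @^-1` W).
Proof.
move=> fl [W1 W2].
have fZ c x : f (c *: x) = c *: f x.
  have f0 : f 0 = 0 by have := fl (-1) 0 0; rewrite scaler0 addr0 scaleN1r addNr.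
  by rewrite -[c *: x]addr0 fl f0 addr0.
split=> [c x c1|t x y t1]; rewrite /preimage/= ?fl fZ; [exact: W1|exact: W2].
Qed.

Lemma absconvex_scale (E : lmodType k) (W : set E) (c : k) :
  absconvex W -> absconvex [set x | W (c *: x)].
Proof.
move=> aW; apply: (absconvex_preimage (f := *:%R c)) aW => a x y.
by rewrite scalerDr !scalerA mulrC.
Qed.

Lemma convex_setP (E : lmodType k) (A : set E) :
  @convex_set k E A <->
  (forall (t : k) x y, 0 <= t <= 1 -> A x -> A y -> A (t *: x + (1 - t) *: y)).
Proof.
split=> [cA t x y /andP[t0 t1] Ax Ay|cA].
  have t01 : Itv.spec (@Itv.num_sem k) (Itv.Real `[0%Z, 1%Z]) t.
    by rewrite /Itv.spec /= /Itv.num_sem /= ger0_real//= in_itv /= t0 t1.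
  have := cA x y (Itv.mk t01); rewrite !inE => /(_ Ax Ay).
  by [].
move=> x y l; rewrite !inE => Ax Ay; apply: cA => //.
by rewrite ge0 le1.
Qed.

Section Tvs.
Variable A : tvsType k.

Lemma nbhs0P (x : A) (U : set A) : nbhs x U <-> nbhs 0 [set y | U (x + y)].
Proof.
split=> [/(nbhsB (- x))|/(nbhsT x)]; rewrite ?addNr.
  by apply: filterS => _ [y Uy <-] /=; rewrite addrA addrN add0r.
by apply: filterS => _ [y Uy <-].
Qed.

(** The balanced core of a convex open [C], the set of x with c x in [C] whenever |c| <= 1, is
    absolutely convex. It is a neighbourhood because scalar multiplication is continuous at (0,
    0). *)
Lemma nbhs0_absconvex (U : set A) : nbhs 0 U ->
  exists W, [/\ W `<=` U, absconvex W & nbhs 0 W].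
Proof.
move=> U0; have [B cB [oB /(_ 0 U U0)[C [BC C0] CU]]] := @locally_convex k A.
have {}cC := (convex_setP C).1 (cB _ (mem_set BC)).
have {}oC : nbhs 0 C by apply: open_nbhs_nbhs; split=> //; exact: oB.
exists [set x | forall c : k, `|c| <= 1 -> C (c *: x)]; split.
- by move=> x /(_ 1); rewrite normr1 scale1r => /(_ (lexx _))/CU.
- split=> [c x c1 Cx a a1|t x y t1 Cx Cy c c1].
    by rewrite scalerA; apply: Cx; rewrite normrM mulr_ile1.
  rewrite scalerDr !scalerA ![c * _]mulrC -!scalerA.
  by apply: cC => //; [exact: Cx|exact: Cy].
have := @scale_continuous k A (0, 0) C; rewrite /= scaler0 => /(_ oC).
move=> [[V1 V2] /= [/nbhs_ballP[d /= d0 dV] V20] V12].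
have d2 : d / 2 != 0 by rewrite gt_eqF// divr_gt0.
have := nbhs0Z d2 V20; apply: filterS => _ [v Vv <-] c c1.
rewrite scalerA; apply: (V12 (c * (d / 2), v)); split=> //=; apply: dV.
rewrite -ball_normE /= sub0r normrN normrM (@gtr0_norm _ (d / 2)) ?divr_gt0//.
apply: le_lt_trans (_ : d / 2 < d); first by rewrite ler_piMl ?divr_ge0// ltW.
by rewrite ltr_pdivrMr// ltr_pMr// ltr1n.
Qed.

Lemma nbhs0_half (U : set A) : nbhs 0 U ->
  exists2 W, nbhs 0 W & forall x y, W x -> W y -> U (x + y).
Proof.
move=> U0; have := @add_continuous A (0, 0) U; rewrite /= addr0 => /(_ U0).
move=> [[V1 V2] /= [V10 V20] V12]; exists (V1 `&` V2); first exact: filterI.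
by move=> x y [Vx _] [_ Vy]; apply: (V12 (x, y)).
Qed.

Lemma hausdorff_eq0 (x : A) : hausdorff_space A ->
  (forall U, nbhs 0 U -> U x) -> x = 0.
Proof.
move=> hA hx; apply/esym; apply: hA => U V U0 Vx.
by exists x; split; [exact: hx|exact: nbhs_singleton].
Qed.

End Tvs.

Lemma linear_continuous0 (A B : tvsType k) (f : A -> B) : linear f ->
  (forall U, nbhs 0 U -> nbhs 0 (f @^-1` U)) -> continuous f.
Proof.
move=> fl hf x U /nbhs0P/hf h; apply/nbhs0P; apply: filterS h => y /=.
have fD : f (x + y) = f x + f y by have := fl 1 x y; rewrite !scale1r.
by rewrite fD.
Qed.

End AbsolutelyConvex.

(** * Presentations by Banach spaces and their finest locally convex topology *)

Section Bounded.
Variables (R : realType) (k : numFieldType) (rs : rscalars R k).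
Local Notation abs := (rabs rs).

(** For linear [g] this is continuity with respect to [N], tested at 0 only. *)
Definition ncont (V : Type) (N : V -> R) (Y : tvsType k) (g : V -> Y) :=
  forall U, nbhs 0 U -> exists2 r : R, 0 < r & forall s, N s < r -> U (g s).

(** Step maps need not be injective and no linking maps are given: a point of one step only has to
    lift to the next one with a norm bound. Kernels, quotients and products then have evident
    presentations. *)
Record pres (E : lmodType k) := Pres {
  step : nat -> lmodType k;
  stepN : forall n, step n -> R;
  step_banach : forall n, banach rs (@stepN n);
  step_map : forall n, {linear step n -> E};
  step_cover : forall y, exists n x, step_map n x = y;
  step_nested : forall n, exists C : R, forall x, exists x',
    step_map n.+1 x' = step_map n x /\ stepN x' <= C * stepN x
}.

Section Final.
Variables (E : lmodType k) (P : pres E).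

(** The neighbourhoods of 0 in the finest locally convex topology making all step maps
    continuous. *)
Definition fnbhs0 (U : set E) := exists W, [/\ W `<=` U, absconvex W &
  forall n, exists2 r : R, 0 < r & forall s, stepN s < r -> W (step_map P n s)].

Lemma fnbhs0_0 U : fnbhs0 U -> U 0.
Proof.
move=> [W [WU aW /(_ 0)[r r0 hr]]]; apply: WU.
by rewrite -(linear0 (step_map P 0)); apply: hr; rewrite (normB0 (step_banach P _)).
Qed.

Lemma fnbhs0S U V : U `<=` V -> fnbhs0 U -> fnbhs0 V.
Proof. by move=> UV [W [WU aW h]]; exists W; split=> // x /WU/UV. Qed.

Lemma fnbhs0I U V : fnbhs0 U -> fnbhs0 V -> fnbhs0 (U `&` V).
Proof.
move=> [W [WU aW hW]] [X [XV aX hX]]; exists (W `&` X); split.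
- by move=> x [/WU ? /XV ?].
- exact: absconvexI.
move=> n; have [r r0 hr] := hW n; have [d d0 hd] := hX n.
by exists (Num.min r d); rewrite ?lt_min ?r0// => s; rewrite lt_min => /andP[/hr ? /hd].
Qed.

Lemma fnbhs0_scale c W : absconvex W ->
  (forall n, exists2 r : R, 0 < r & forall s, stepN s < r -> W (step_map P n s)) ->
  (forall n, exists2 r : R, 0 < r & forall s, stepN s < r ->
    W (c *: step_map P n s)).
Proof.
move=> aW hW n; have [r r0 hr] := hW n.
exists (r / (abs c + 1)); first by rewrite divr_gt0// ltr_wpDl ?rabs_ge0.
move=> s; rewrite ltr_pdivlMr ?ltr_wpDl ?rabs_ge0// => h.
rewrite -linearZ /=; apply: hr; rewrite (normB_Z (step_banach P n)).
apply: le_lt_trans h; rewrite mulrDr mulr1 mulrC lerDl.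
exact: normB_ge0 (step_banach P n) s.
Qed.

Definition finT of pres E : Type := E.
Local Notation T := (finT P).
HB.instance Definition _ := GRing.Lmodule.on T.
HB.instance Definition _ :=
  hasNbhs.Build T (fun (x : T) (A : set T) => fnbhs0 [set y : E | A ((x : E) + y)]).

Lemma finT_nbhs (x : T) (A : set T) :
  nbhs x A = fnbhs0 [set y : E | A ((x : E) + y)].
Proof. by []. Qed.

Lemma finT_nbhs0 (A : set T) : nbhs (0 : T) A = fnbhs0 A.
Proof.
rewrite finT_nbhs; congr fnbhs0; apply/funext => y /=; congr (A _).
exact: add0r.
Qed.

Let T_filter (p : T) : ProperFilter (nbhs p).
Proof.
split; first by move=> /fnbhs0_0.
split.
- exists setT; split; [by []|by split|].
  by move=> n; exists 1 => //; exact: ltr01.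
- by move=> U V hU hV; exact: fnbhs0I hU hV.
- by move=> U V UV; apply: fnbhs0S => x; exact: UV.
Qed.

Let T_singleton (p : T) (A : set T) : nbhs p A -> A p.
Proof. by move=> /fnbhs0_0; rewrite /= addr0. Qed.

Let T_nbhs (p : T) (A : set T) : nbhs p A -> nbhs p (nbhs^~ A).
Proof.
(* The set W/2 works: W/2 + W/2 lies in W by convexity. *)
move=> [W [WA aW hW]]; exists [set x | W (2 *: x)]; split; last 2 first.
- exact: absconvex_scale.
- exact: fnbhs0_scale.
move=> x W2x; exists [set x | W (2 *: x)]; split; last 2 first.
- exact: absconvex_scale.
- exact: fnbhs0_scale.
move=> y W2y /=; rewrite -addrA; apply: WA.
have := absconvex_half aW W2x W2y.
by rewrite -scalerDr scalerA mulVf ?pnatr_eq0// scale1r.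
Qed.

HB.instance Definition _ :=
  Nbhs_isNbhsTopological.Build T T_filter T_singleton T_nbhs.

Let T_add : continuous (fun x : T * T => x.1 + x.2).
Proof.
move=> [x y] A /= [W [WA aW hW]].
pose V : set E := [set x | W (2 *: x)].
have V0 z : nbhs (z : T) [set u : T | V ((u : E) - z)].
  exists V; split; [|exact: absconvex_scale|exact: fnbhs0_scale].
  by move=> u Vu /=; rewrite addrC addKr.
exists ([set u : T | V ((u : E) - x)], [set u : T | V ((u : E) - y)]).
  by split; exact: V0.
move=> [u v] /= [Vu Vv].
have := absconvex_half aW Vu Vv.
rewrite -scalerDr scalerA mulVf ?pnatr_eq0// scale1r => h.
have e : (x : E) + (y : E) + ((u : E) - x + ((v : E) - y)) = (u : E) + v.
  by rewrite [X in _ + X]addrACA -opprD subrKC.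
exact: (eq_ind _ A (WA _ h) _ e).
Qed.

Let T_scale : continuous (fun z : k^o * T => z.1 *: z.2).
Proof.
move=> [a x] A /= [W [WA aW hW]].
(* Here b u = a x + (b - a) x + b (u - x). The first error is controlled by choosing [d] relative to
   the norm of a lift of x, the second by scaling with [M], a bound for |b|. *)
have [n [s sx]] := step_cover P (x : E).
have [r r0 hr] := fnbhs0_scale 2 aW hW n.
have N0 : 0 < stepN s + 1 by rewrite ltr_wpDl ?(normB_ge0 (step_banach P n)).
pose d := Num.min 1 (r / (stepN s + 1)).
have d0 : 0 < d by rewrite lt_min ltr01 divr_gt0.
pose M := `|a| + 1; have M0 : 0 < M by rewrite ltr_wpDl.
pose V : set E := [set x | W ((2 * M) *: x)].
exists (ball (a : k^o) (remb rs d), [set u : T | V ((u : E) - x)]).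
  split=> /=.
    by apply: nbhsx_ballx; rewrite -(rmorph0 (remb rs)) remb_lt.
  exists V; split; [|exact: absconvex_scale|exact: fnbhs0_scale].
  by move=> u Vu /=; rewrite addrC addKr.
move=> [b u] /= [ab Vu].
have {}ab : abs (b - a) < d.
  by move: ab; rewrite -ball_normE /= distrC -(rembK rs) remb_lt.
have bM : `|b / M| <= 1.
  rewrite normf_div (gtr0_norm M0) ler_pdivrMr// mul1r /M.
  rewrite -[b](subrK a) (le_trans (ler_normD _ _))// addrC lerD//.
  rewrite -(rembK rs) -(rmorph1 (remb rs)) remb_le ltW//.
  by move: ab; rewrite lt_min => /andP[].
have h1 : W (2 *: ((b - a) *: (x : E))).
  rewrite -sx -[_ *: step_map P n s]linearZ /=; apply: hr; rewrite (normB_Z (step_banach P n)).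
  move: ab; rewrite lt_min => /andP[_]; rewrite ltr_pdivlMr// mulrDr.
  by apply: le_lt_trans; rewrite lerDl mulr1 rabs_ge0.
have := absconvex_half aW h1 (aW.1 _ _ bM Vu).
rewrite !scalerA.
have -> : b / M * (2 * M) = 2 * b by field; rewrite gt_eqF.
rewrite -!scalerA -scalerDr scalerA mulVf ?pnatr_eq0// scale1r => h.
have e : a *: (x : E) + ((b - a) *: (x : E) + b *: ((u : E) - x)) = b *: (u : E).
  by rewrite scalerBl scalerBr [X in _ + X]addrC subrKA subrKC.
exact: (eq_ind _ A (WA _ h) _ e).
Qed.

Let T_convex : exists2 B : set_system T,
  (forall b, b \in B -> @convex_set k T b) & basis B.
Proof.
exists [set A | @convex_set k T A /\ open A].
  by move=> b /[!inE] -[].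
split; first by move=> A [].
move=> x A [W [WA aW hW]].
pose C : set T := [set u : T | W ((u : E) - x)].
have cC (t : k) (u v : E) : 0 <= t <= 1 -> C u -> C v -> C (t *: u + (1 - t) *: v).
  move=> t1 Cu Cv; have := aW.2 _ _ _ t1 Cu Cv; rewrite /C /=.
  by rewrite !scalerBr addrACA -opprD -scalerDl subrKC scale1r.
exists (interior C); last first.
  by move=> u /interior_subset /WA /=; rewrite addrC subrK.
split; last first.
  by exists W; split=> // y Wy; rewrite /C /= addrC addKr.
split; last exact: open_interior.
(* The interior of the convex set [C] is convex: if u + U and v + V lie in [C], so does any convex
   combination of u and v translated by the intersection of U and V. *)
apply/convex_setP => t u v t1 [U [Uu aU hU]] [V [Vv aV hV]].
exists (U `&` V); split; first 2 last.
- move=> n; have [r r0 hr] := hU n; have [d d0 hd] := hV n.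
  by exists (Num.min r d); rewrite ?lt_min ?r0// => s; rewrite lt_min => /andP[/hr ? /hd].
- move=> y [/Uu Cu /Vv Cv]; have := cC _ _ _ t1 Cu Cv; rewrite /=.
  rewrite !scalerDr addrACA -[X in _ + X]scalerDl.
  by rewrite subrKC scale1r.
exact: absconvexI.
Qed.

HB.instance Definition _ :=
  PreTopologicalLmod_isTvs.Build k T T_add T_scale T_convex.
HB.instance Definition _ :=
  PreTopologicalNmodule_isTopologicalNmodule.Build T T_add.
HB.instance Definition _ :=
  TopologicalNmodule_isTopologicalLmodule.Build k T T_scale.
HB.instance Definition _ := Uniform_isTvs.Build k T T_convex.

End Final.
End Bounded.

(** * Subspaces and quotients of vector spaces *)

Section LinearAlgebra.
Variable k : numFieldType.

Definition mklin (U V : lmodType k) (f : U -> V) (fl : linear f) :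
    {linear U -> V} :=
  HB.pack f (GRing.isLinear.Build k U V *:%R f fl).

Lemma linear_fun0 (U V : lmodType k) (f : U -> V) : linear f -> f 0 = 0.
Proof. by move=> fl; exact: (linear0 (mklin fl)). Qed.

Lemma linear_funB (U V : lmodType k) (f : U -> V) x y :
  linear f -> f (x - y) = f x - f y.
Proof. by move=> fl; exact: (linearB (mklin fl)). Qed.

Lemma linear_funZ (U V : lmodType k) (f : U -> V) a x :
  linear f -> f (a *: x) = a *: f x.
Proof. by move=> fl; exact: (linearZZ (mklin fl)). Qed.

Definition lsubspace (E : lmodType k) (Q : set E) :=
  Q 0 /\ forall a x y, Q x -> Q y -> Q (a *: x + y).

Section Sub.
Variables (E : lmodType k) (Q : set E) (hQ : lsubspace Q).

(** The closure proof is an argument so that the algebraic structures can be inferred from the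
    predicate. *)
Definition spred of lsubspace Q : {pred E} := fun x => `[< Q x >].

Let spred_closed : GRing.submod_closed (spred hQ).
Proof.
split=> [|a x y]; first by apply/asboolP; case: hQ.
by move=> /asboolP Qx /asboolP Qy; apply/asboolP; exact: hQ.2.
Qed.

HB.instance Definition _ := GRing.isSubmodClosed.Build k E (spred hQ)
  (GRing.submod_closed_semi spred_closed).

Record subT := SubT { subT_val :> E; subT_in : subT_val \in spred hQ }.
HB.instance Definition _ := [isSub for subT_val].
HB.instance Definition _ := [Choice of subT by <:].
HB.instance Definition _ := [SubChoice_isSubLmodule of subT by <:].

Definition subT_mk x (Qx : Q x) : subT := SubT (asboolT Qx : x \in spred hQ).

Lemma subTP (x : subT) : Q (x : E).
Proof. exact: (asboolW (subT_in x)). Qed.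

Lemma subT_inj : injective subT_val. Proof. exact: val_inj. Qed.

Lemma subT_val_linear : linear subT_val. Proof. by []. Qed.
HB.instance Definition _ := GRing.isLinear.Build k subT E *:%R subT_val subT_val_linear.

Definition quotT : Type := (@Quotient.quot E (spred hQ)).
HB.instance Definition _ := GRing.Zmodule.on quotT.

Definition quot_pi (x : E) : quotT := \pi_(@Quotient.quot E (spred hQ))%qT x.

Lemma quot_pi_surj (q : quotT) : exists x, quot_pi x = q.
Proof. by exists (repr (q : (@Quotient.quot E (spred hQ)))); rewrite /quot_pi reprK. Qed.

Lemma quot_piP x y : quot_pi x = quot_pi y <-> Q (x - y).
Proof.
split=> [/eqP|h].
  by rewrite /quot_pi -Quotient.idealrBE => /asboolP.
by apply/eqP; rewrite /quot_pi -Quotient.idealrBE; apply/asboolP.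
Qed.

Lemma quot_piD x y : quot_pi (x + y) = quot_pi x + quot_pi y.
Proof. by rewrite /quot_pi !piE. Qed.

Let scaleq a (q : quotT) : quotT :=
  quot_pi (a *: repr (q : (@Quotient.quot E (spred hQ)))).

Let scaleq_pi a x : scaleq a (quot_pi x) = quot_pi (a *: x).
Proof.
apply/quot_piP; rewrite -scalerBr -[_ *: _]addr0; apply: hQ.2; last exact: hQ.1.
by apply/quot_piP; rewrite /quot_pi reprK.
Qed.

Let scaleqA a b q : scaleq a (scaleq b q) = scaleq (a * b) q.
Proof. by have [x <-] := quot_pi_surj q; rewrite !scaleq_pi scalerA. Qed.

Let scaleq1 : left_id 1 scaleq.
Proof. by move=> q; have [x <-] := quot_pi_surj q; rewrite scaleq_pi scale1r. Qed.

Let scaleqDr : right_distributive scaleq +%R.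
Proof.
move=> a p q; have [x <-] := quot_pi_surj p; have [y <-] := quot_pi_surj q.
by rewrite -quot_piD !scaleq_pi scalerDr quot_piD.
Qed.

Let scaleqDl q : {morph scaleq^~ q : a b / a + b}.
Proof.
move=> a b; have [x <-] := quot_pi_surj q.
by rewrite !scaleq_pi scalerDl quot_piD.
Qed.

HB.instance Definition _ := GRing.Zmodule_isLmodule.Build k quotT
  scaleqA scaleq1 scaleqDr scaleqDl.

Lemma quot_pi_linear : linear quot_pi.
Proof. by move=> a x y; rewrite quot_piD -scaleq_pi. Qed.
HB.instance Definition _ :=
  GRing.isLinear.Build k E quotT *:%R quot_pi quot_pi_linear.

End Sub.
End LinearAlgebra.
Arguments subT_val {k E Q hQ} _.

(** * Quotient norms *)

Section ImageNorm.
Variables (R : realType) (k : numFieldType) (rs : rscalars R k).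
Variables (V W : lmodType k) (N : V -> R) (bN : banach rs N).
Variables (q : {linear V -> W}) (q_surj : forall w, exists v, q v = w).
Hypothesis q_sep : forall w,
  (forall e : R, 0 < e -> exists2 v, q v = w & N v < e) -> w = 0.

(** The quotient norm; [q_sep] is the form in which closedness of the kernel of [q] makes it
    definite. *)
Definition image_norm (w : W) : R := inf [set N v | v in [set v | q v = w]].

Let lbN w : has_lbound [set N v | v in [set v | q v = w]].
Proof. by exists 0 => _ [v _ <-]; exact: normB_ge0 bN v. Qed.

Lemma image_norm_le v : image_norm (q v) <= N v.
Proof. by apply: ge_inf; [exact: lbN|exists v]. Qed.

Lemma image_norm_lt w e : image_norm w < e -> exists2 v, q v = w & N v < e.
Proof.
move=> h; have ne : [set N v | v in [set v | q v = w]] !=set0.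
  by have [v vw] := q_surj w; exists (N v), v.
by have [_ [v <- <-] h'] := inf_lt ne h; exists v.
Qed.

(** For completeness, the increments are lifted to [V] with norm below (C + 1) [geo n], the lifts
    are summed there, and the limit is projected back. *)
Lemma image_norm_banach : banach rs image_norm.
Proof.
have le0 w : 0 <= image_norm w.
  apply: lb_le_inf; first by have [v vw] := q_surj w; exists (N v), v.
  by move=> _ [v _ <-]; exact: normB_ge0 bN v.
have Zle a w : image_norm (a *: w) <= rabs rs a * image_norm w.
  apply/ler_addgt0Pr => e e0.
  have d0 : 0 < e / (rabs rs a + 1) by rewrite divr_gt0// ltr_wpDl ?rabs_ge0.
  have [v <- hv] : exists2 v, q v = w & N v < image_norm w + e / (rabs rs a + 1).
    by apply: image_norm_lt; rewrite ltrDl.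
  rewrite -linearZ; apply: le_trans (image_norm_le _) _.
  rewrite (normB_Z bN); apply: le_trans (_ : rabs rs a *
    (image_norm (q v) + e / (rabs rs a + 1)) <= _).
    by rewrite ler_wpM2l ?rabs_ge0// ltW.
  rewrite mulrDr lerD2l mulrCA ler_piMr// ?(ltW e0)//.
  by rewrite ler_pdivrMr ?ltr_wpDl ?rabs_ge0// mul1r lerDl.
split.
- move=> x y; apply/ler_addgt0Pr => e e0.
  have [|v <- hv] := @image_norm_lt x (image_norm x + e / 2).
    by rewrite ltrDl divr_gt0.
  have [|w <- hw] := @image_norm_lt y (image_norm y + e / 2).
    by rewrite ltrDl divr_gt0.
  rewrite -linearD; apply: le_trans (image_norm_le _) _.
  by apply: le_trans (normB_D bN _ _) _; lra.
- move=> a w; apply/eqP; rewrite eq_le Zle/=.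
  have [->|a0] := eqVneq a 0; first by rewrite rabs0 mul0r.
  have := Zle a^-1 (a *: w); rewrite scalerA mulVf// scale1r rabsV.
  by rewrite mulrC ler_pdivlMr ?rabs_pos // mulrC.
- by move=> w w0; apply: q_sep => e e0; apply: image_norm_lt; rewrite w0.
move=> u C hu.
have ex n : exists v, q v = u n.+1 - u n /\ N v < (C + 1) * geo n.
  have [|v] := @image_norm_lt (u n.+1 - u n) ((C + 1) * geo n); last by exists v.
  by apply: le_lt_trans (hu n) _; rewrite mulrDl ltrDl mul1r geo_gt0.
have [s hs] := choice ex; have [s0 s0u] := q_surj (u 0%N).
pose t := fix t n := if n is m.+1 then t m + s m else s0.
have tu n : q (t n) = u n.
  by elim: n => //= n IH; rewrite linearD IH (hs n).1 subrKC.
have [|l [M hl]] := normB_complete bN (u := t) (C := C + 1).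
  by move=> n; rewrite /= [t n + _]addrC addrK ltW// (hs n).2.
exists (q l), M => n; rewrite -tu -linearB.
exact: le_trans (image_norm_le _) (hl n).
Qed.

End ImageNorm.

(** * LB-spaces as spaces with a presentation *)

Section Presentations.
Variables (R : realType) (k : numFieldType) (rs : rscalars R k).
Local Notation abs := (rabs rs).
Local Notation emb := (remb rs).

Lemma nbhs0_norm (S : normedModType k) (U : set S) :
  nbhs 0 U <-> exists2 r : R, 0 < r & forall s : S, abs `|s| < r -> U s.
Proof.
split=> [/nbhs_ballP[e /= e0 he]|[r r0 hr]].
  exists (abs e) => [|s se]; first exact: rabs_gt0.
  by apply: he; rewrite -ball_normE /= sub0r normrN -(remb_pos rs e0)
    -[ltLHS]normr_id -(rembK rs) remb_lt.
apply/nbhs_ballP; exists (emb r); first by rewrite /= -(rmorph0 emb) remb_lt.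
move=> s; rewrite -ball_normE /= sub0r normrN => se; apply: hr.
by rewrite -(remb_lt rs) rembK normr_id.
Qed.

Lemma ncont_bound (V W : lmodType k) (N : V -> R) (N' : W -> R)
    (g : {linear V -> W}) : banach rs N -> banach rs N' ->
  (exists2 r : R, 0 < r & forall s, N s < r -> N' (g s) < 1) ->
  exists2 C : R, 0 <= C & forall s, N' (g s) <= C * N s.
Proof.
move=> bN bN' [r r0 hr]; exists (2 / r); first by rewrite divr_ge0// ltW.
move=> s; have [s0|s0] := eqVneq (N s) 0.
  by rewrite (normB_eq0 bN s0) linear0 (normB0 bN') (normB0 bN) mulr0.
have {}s0 : 0 < N s by rewrite lt_neqAle eq_sym s0 (normB_ge0 bN).
(* The factor that brings s to norm r / 2. *)
pose c := r / (2 * N s); have c0 : 0 < c by rewrite divr_gt0// mulr_gt0.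
have := hr (emb c *: s); rewrite linearZ (normB_Z bN) (normB_Z bN') (rabs_emb rs (ltW c0)).
have -> : c * N s = r / 2 by rewrite /c; field; rewrite gt_eqF.
rewrite ltr_pdivrMr// ltr_pMr// ltr1n => /(_ isT) /ltW h.
have -> : 2 / r * N s = c^-1 by rewrite /c; field; rewrite !gt_eqF.
by rewrite -[leRHS]mul1r ler_pdivlMr// mulrC.
Qed.

Lemma bnT_nbhs0 (V : lmodType k) (N : V -> R) (bN : banach rs N)
    (U : set (bnT bN)) :
  nbhs 0 U <-> exists2 r : R, 0 < r & forall s : V, N s < r -> U s.
Proof.
apply: (iff_trans (nbhs0_norm U)).
have E (s : bnT bN) : abs `|s| = N s.
  by rewrite bnT_norm rabs_emb// (normB_ge0 bN).
by split=> -[r r0 hr]; exists r => // s h; apply: hr; rewrite ?E// -E.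
Qed.

Definition presents (A : tvsType k) (P : pres rs A) :=
  forall U, nbhs (0 : A) U <-> fnbhs0 P U.

Section FinPres.
Variables (E : lmodType k) (P : pres rs E).

Let fin_map_linear n : linear (step_map P n : step P n -> finT P).
Proof. by move=> a x y; rewrite linearP. Qed.

Let fin_cover (y : finT P) :
  exists n x, (mklin (@fin_map_linear n) : step P n -> finT P) x = y.
Proof. exact: step_cover P (y : E). Qed.

Definition fin_pres : pres rs (finT P) :=
  @Pres R k rs (finT P) (step P) (@stepN _ _ _ _ P) (step_banach P)
    (fun n => mklin (@fin_map_linear n)) fin_cover (step_nested P).

Lemma fin_presents : presents fin_pres.
Proof. by move=> U; rewrite finT_nbhs0. Qed.

End FinPres.

Lemma pres_ncont (A : tvsType k) (P : pres rs A) (B : tvsType k) (f : A -> B) :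
  presents P -> linear f -> continuous f ->
  forall n, ncont (@stepN _ _ _ _ P n) (f \o step_map P n).
Proof.
move=> hP fl fc n U U0.
have /hP[W [WU aW /(_ n)[r r0 hr]]] : nbhs 0 (f @^-1` U).
  by apply: fc; rewrite (linear_fun0 fl).
by exists r => // s /hr/WU.
Qed.

Lemma ncont_fnbhs0 (E : lmodType k) (P : pres rs E) (B : tvsType k) (f : E -> B) :
  linear f -> (forall n, ncont (@stepN _ _ _ _ P n) (f \o step_map P n)) ->
  forall U, nbhs 0 U -> fnbhs0 P (f @^-1` U).
Proof.
move=> fl hf U /nbhs0_absconvex[W [WU aW W0]]; exists (f @^-1` W); split.
- by move=> x /WU.
- exact: absconvex_preimage.
by move=> n; exact: hf.
Qed.

Lemma pres_continuous (A : tvsType k) (P : pres rs A) (B : tvsType k) (f : A -> B) :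
  presents P -> linear f ->
  (forall n, ncont (@stepN _ _ _ _ P n) (f \o step_map P n)) -> continuous f.
Proof.
move=> hP fl hf; apply: linear_continuous0 => // U U0.
by apply/hP; exact: ncont_fnbhs0.
Qed.

Lemma step_ncont (A : tvsType k) (P : pres rs A) n :
  presents P -> ncont (@stepN _ _ _ _ P n) (step_map P n : _ -> A).
Proof.
move=> hP; apply: (@pres_ncont A P A id) => //; last by move=> x; exact: cvg_id.
Qed.

(** Bounds for the lifts come from continuity of the linking maps. That the topology is fine enough
    follows from its maximality, applied to the identity from [A] to [finT P]. *)
Lemma LB_presents (A : LBspace k) : exists P : pres rs A, presents P.
Proof.
case: A => A [hA [S [u [j [[ju jc jk] [jcont jfin]]]]]] /=.
have bS n := banach_complete rs (S n).
have ju' n : exists C : R, forall x, exists x',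
    j n.+1 x' = j n x /\ abs `|x'| <= C * abs `|x|.
  have [|C C0 hC] := @ncont_bound _ _ _ _ (mklin (lcfun_linear (u n))) (bS n) (bS n.+1).
    apply/(nbhs0_norm ((u n) @^-1` [set y | abs `|y| < 1])).
    apply: lcfun_continuous; rewrite linear0.
    by apply/(nbhs0_norm [set y : S n.+1 | abs `|y| < 1]); exists 1.
  exists C => x; exists (u n x); split; [exact: ju|exact: hC].
pose P : pres rs A := @Pres R k rs A S (fun n x => abs `|x|) bS j jc ju'.
exists P => U; split=> [/nbhs0_absconvex[W [WU aW W0]]|hU].
  exists W; split=> // n; apply/(nbhs0_norm (j n @^-1` W)).
  by apply: jcont; rewrite linear0.
have phil : linear (id : A -> finT P) by [].
have phic : continuous (mklin phil).
  apply: jfin => [|n]; first by exists id.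
  apply: linear_continuous0 => [a x y|V /fin_presents[W [WV aW /(_ n)[r r0 hr]]]].
    by rewrite /= linearP.
  by apply/(nbhs0_norm (S := S n)); exists r => // s /hr/WV.
have := phic 0 U; rewrite linear0 => /(_ _)h; apply: h.
by apply/fin_presents.
Qed.

Section Make.
Variables (E : lmodType k) (P : pres rs E).

(** A Hausdorff criterion for [finT P] that needs maps continuous on the steps only, hence is easy
    to check for kernels, quotients and products. *)
Definition point_separated := forall v : E, v <> 0 ->
  exists (Y : tvsType k) (h : E -> Y), [/\ hausdorff_space Y, linear h,
    (forall n, ncont (@stepN _ _ _ _ P n) (h \o step_map P n)) & h v <> 0].

Hypothesis sepP : point_separated.

Lemma finT_hausdorff : hausdorff_space (finT P).
Proof.
move=> p q pq; apply: contrapT => ne.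
have [|Y [h [hY hl hc]]] := sepP (v := (p : E) - q).
  by move=> /eqP; rewrite subr_eq0 => /eqP.
have hcont : continuous (h : finT P -> Y).
  exact: @pres_continuous _ (fin_pres P) _ _ (@fin_presents _ P) hl hc.
rewrite (linear_funB _ _ hl); apply; apply/eqP; rewrite subr_eq0; apply/eqP/hY => A B hA hB.
have [x [Ax Bx]] := pq _ _ (hcont p _ hA) (hcont q _ hB).
by exists (h x).
Qed.

(** An LB-space requires linking maps, which a presentation lacks. Each step is therefore replaced
    by its image in [E] with the quotient norm, and the linking maps become inclusions. *)
Let rg n : set E := [set v | exists s, step_map P n s = v].

Let rg_subspace n : lsubspace (rg n).
Proof.
split; first exact: (ex_intro _ 0 (linear0 _)).
move=> a u v [x xu] [y yv]; apply: (ex_intro _ (a *: x + y)).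
by rewrite linearP xu yv.
Qed.

Let Rg n : lmodType k := subT (rg_subspace n).

Let q n (s : step P n) : Rg n := subT_mk _ (ex_intro _ s erefl).

Let q_linear n : linear (@q n).
Proof. by move=> a x y; apply: subT_inj; rewrite linearP /= linearP. Qed.

Let ql n : {linear step P n -> Rg n} := mklin (@q_linear n).

Let q_surj n w : exists v, ql n v = w.
Proof. by have [s hs] := subTP w; exists s; apply: subT_inj. Qed.

(** A map continuous on the step sends a vector with arbitrarily small lifts into every
    neighbourhood of 0, so no such map can separate it from 0. *)
Let q_sep n (w : Rg n) :
  (forall e : R, 0 < e -> exists2 v, ql n v = w & stepN v < e) -> w = 0.
Proof.
move=> hw; apply: subT_inj; rewrite linear0; apply: contrapT => w0.
have [Y [h [hY hl hc]]] := sepP w0; apply; apply: hausdorff_eq0 hY _ => U U0.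
by have [r r0 hr] := hc n U U0; have [v <- /hr] := hw r r0.
Qed.

Let bRg n : banach rs (image_norm (@stepN _ _ _ _ P n) (ql n)) :=
  image_norm_banach (step_banach P n) (@q_surj n) (@q_sep n).

Let S n : completeNormedModType k := bnT (bRg n).

Let incl_subproof n (v : Rg n) : rg n.+1 v.
Proof.
have [s <-] := subTP v; have [C hC] := step_nested P n.
by have [s' [h _]] := hC s; exists s'.
Qed.

Let incl n (v : S n) : S n.+1 := subT_mk (rg_subspace n.+1) (@incl_subproof n v).

Let incl_linear n : linear (@incl n).
Proof. by move=> a x y; apply: subT_inj. Qed.

Let incl_continuous n : continuous (@incl n).
Proof.
apply: linear_continuous0; first exact: incl_linear.
move=> U /bnT_nbhs0[r r0 hr]; apply/bnT_nbhs0.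
have [C hC] := step_nested P n.
exists (r / (`|C| + 1)); first by rewrite divr_gt0// ltr_wpDl.
move=> v vr; apply: hr; have [s <- hs] := image_norm_lt (@q_surj n) vr.
have [s' [h1 h2]] := hC s.
have -> : @incl n (ql n s) = ql n.+1 s' by apply: subT_inj.
apply: le_lt_trans (image_norm_le (step_banach P n.+1) _ _) _.
move: hs; rewrite ltr_pdivlMr ?ltr_wpDl//; apply: le_lt_trans.
apply: le_trans h2 _; rewrite mulrC ler_wpM2l ?(normB_ge0 (step_banach P n))//.
by rewrite (le_trans (ler_norm C))// lerDl.
Qed.

Let incl_lc n : @incl n \in @lcfun_pred k (S n) (S n.+1).
Proof. by apply/asboolP; split; [exact: incl_linear|exact: incl_continuous]. Qed.

Let vl n : linear (fun v : S n => (subT_val (v : Rg n) : finT P)).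
Proof. by []. Qed.

Let jv n : {linear S n -> finT P} := mklin (@vl n).

Lemma finT_isLB : is_LB (finT P).
Proof.
split; first exact: finT_hausdorff.
exists S, (fun n => LCFun (@incl_lc n)), jv; split; split.
- by [].
- move=> y; have [n [s sy]] := step_cover P (y : E).
  by exists n, (ql n s).
- by move=> n x x0; exists 0%N; apply: subT_inj; rewrite linear0.
- move=> n; apply: linear_continuous0; first exact: vl.
  move=> U /fin_presents[W [WU aW /(_ n)[r r0 hr]]]; apply/bnT_nbhs0.
  by exists r => // v /(image_norm_lt (@q_surj n))[s <- /hr/WU].
(* Continuity on the images passes to the original steps, because the quotient maps do not increase
   norms. *)
move=> F phi _ hphi; apply: (@pres_continuous _ (fin_pres P) _ _ (@fin_presents _ P)).
  by move=> a x y; rewrite linearP.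
move=> n U U0.
have /bnT_nbhs0[r r0 hr] : nbhs (0 : S n) ((phi \o jv n) @^-1` U).
  by apply: hphi; rewrite /= !linear0.
exists r => // s sr; apply: (hr (ql n s)).
exact: le_lt_trans (image_norm_le (step_banach P n) _ _) sr.
Qed.

Definition mkLB : LBspace k := {| LB_tvs := finT P; LB_isLB := finT_isLB |}.
End Make.
End Presentations.

(** * Baire category and bounded lifting *)

Section Selection.
Variables (R : realType) (k : numFieldType) (rs : rscalars R k).
Local Notation abs := (rabs rs).
Local Notation emb := (remb rs).

(** Baire's theorem for sets that need not be closed: some [A p] is dense in a ball. Otherwise
    shrinking balls converge to a point outside every [A p]. *)
Lemma baire_ball (V : lmodType k) (N : V -> R) (A : nat -> set V) :
  banach rs N -> (forall t, exists p, A p t) ->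
  exists p x (r : R), 0 < r /\ forall y, N (y - x) < r ->
    forall e : R, 0 < e -> exists2 z, A p z & N (y - z) < e.
Proof.
move=> bN cov; apply: contrapT => H.
have {}H p x r : 0 < r -> exists y (e : R),
    [/\ N (y - x) < r, 0 < e & forall z, A p z -> e <= N (y - z)].
  move=> r0; apply: contrapT => H'; apply: H; exists p, x, r; split=> // y yr e e0.
  apply: contrapT => H; apply: H'; exists y, e; split=> // z Az.
  by rewrite leNgt; apply/negP => ze; apply: H; exists z.
(* The new ball has at most half the old radius, its centre moves by at most that much, and its
   radius is at most half the distance from its centre to [A p]. *)
have st (s : nat * (V * R)) : exists t : V * R, 0 < s.2.2 ->
    [/\ 0 < t.2, t.2 <= s.2.2 / 2, N (t.1 - s.2.1) <= s.2.2 / 2 &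
        forall z, A s.1 z -> 2 * t.2 <= N (t.1 - z)].
  case: s => p [x r] /=; have [r0|] := ltP 0 r; last by exists (x, r).
  have [|y [e [yr e0 he]]] := H p x (r / 2); first by rewrite divr_gt0.
  exists (y, Num.min (r / 2) (e / 2)) => _ /=; split.
  - by rewrite lt_min !divr_gt0.
  - by rewrite ge_min lexx.
  - exact: ltW.
  move=> z /he; apply: le_trans.
  by rewrite mulrC -ler_pdivlMr// ge_min lexx orbT.
have [F hF] := choice st.
pose s := fix s n := if n is m.+1 then F (m, s m) else (0 : V, 1 : R).
have s0 n : 0 < (s n).2 by elim: n => //= n /(hF (n, s n))[].
have hs n := hF (n, s n) (s0 n).
have sg m n : (s (n + m)%N).2 <= (s m).2 * geo n.
  elim: n => [|n IH]; first by rewrite add0n geo0 mulr1.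
  have [_ h _ _] := hs (n + m)%N; apply: le_trans h _.
  by rewrite geoS mulrA ler_pM2r ?invr_gt0.
have su m n : N ((s (n.+1 + m)%N).1 - (s (n + m)%N).1) <= (s m).2 / 2 * geo n.
  have [_ _ h _] := hs (n + m)%N; apply: le_trans h _.
  by rewrite /= mulrAC ler_pM2r ?invr_gt0.
have [l [M hl]] : exists l M, forall n, N (l - (s n).1) <= M * geo n.
  apply: (normB_complete bN (u := fun n => (s n).1) (C := 1 / 2)) => n.
  have := su 0%N n; rewrite !addn0 => h; exact: h.
(* The limit lies in some [A p], yet it is within the radius of ball p + 1, whose centre is at least
   twice that radius away from [A p]. *)
have [p Al] := cov l; have [_ _ _ /(_ l Al)] := hs p; apply/negP; rewrite -ltNge.
have h : N (l - (s p.+1).1) <= 2 * ((s p.+1).2 / 2).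
  apply: (@normB_fast_bound _ _ _ _ _ bN (fun n => (s (n + p.+1)%N).1) _ l `|M|).
    by move=> n; exact: su.
  move=> n; apply: le_trans (hl _) _; apply: (@le_trans _ _ (`|M| * geo (n + p.+1))).
    by rewrite ler_wpM2r ?geo_ge0 ?ler_norm.
  by rewrite ler_wpM2l// /geo exprD ler_piMr ?geo_le1// geo_ge0.
rewrite (normB_B bN); apply: le_lt_trans h _.
by rewrite ltr_pM2l// ltr_pdivrMr// ltr_pMr// ltr1n.
Qed.

Section Statement.
Variables (T : lmodType k) (NT : T -> R) (bT : banach rs NT).
Variables (S : nat -> lmodType k) (NS : forall m, S m -> R).
Variables (bS : forall m, banach rs (@NS m)) (Y : tvsType k).
Variables (alpha : {linear T -> Y}) (beta : forall m, {linear S m -> Y}).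
Hypotheses (Yhaus : hausdorff_space Y) (alphac : ncont NT alpha).
Hypotheses (betac : forall m, ncont (@NS m) (beta m)).
Hypothesis covered : forall t, exists m s, beta m s = alpha t.

(** The points lifting to step m with norm at most i, for varying m and i, cover [T], so one such
    set is dense in a ball around some x. Approximating x + c t and x, subtracting and dividing by c
    approximates t. *)
Let approx : exists m (K : R), 0 <= K /\ forall t, exists z s,
  [/\ beta m s = alpha z, NS s <= K * NT t & NT (t - z) <= NT t / 2].
Proof.
(* Pairs (m, i) are enumerated through [pickle]; numbers that code no pair give the empty set. *)
pose A p : set T := if @unpickle (nat * nat)%type p is Some mi
  then [set t | exists2 s, NS s <= mi.2%:R & beta mi.1 s = alpha t] else set0.
have [t|p [x [r [r0 hr]]]] := @baire_ball T NT A bT.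
  have [m [s hs]] := covered t.
  exists (pickle (m, Num.bound (NS s))); rewrite /A pickleK /=.
  by exists s => //; apply/ltW/archi_boundP/normB_ge0/bS.
have Ax y : NT (y - x) < r -> forall e : R, 0 < e -> exists2 z, A p z & NT (y - z) < e.
  exact: hr.
have xr : NT (x - x) < r by rewrite subrr (normB0 bT).
move: Ax; rewrite /A; case: unpickle => [[m i] /=|] Ax; last first.
  by have [z []] := Ax x xr 1 ltr01.
(* The difference of two lifts has norm at most 2 i, and c^-1 = 2 [NT t] / r. *)
exists m, (4 * i%:R / r); split; first by rewrite divr_ge0 ?mulr_ge0 ?(ltW r0).
move=> t; have [t0|t0] := eqVneq (NT t) 0.
  exists 0, 0; rewrite !linear0 addr0 t0 mul0r mulr0 (normB0 (bS m)); split=> //.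
have {}t0 : 0 < NT t by rewrite lt_neqAle eq_sym t0 (normB_ge0 bT).
pose c := r / (2 * NT t); have c0 : 0 < c by rewrite divr_gt0// mulr_gt0.
(* Two errors below r / 8, divided by c, add up to at most [NT t] / 2. *)
have r8 : 0 < r / 8 by rewrite divr_gt0.
have yr : NT (x + emb c *: t - x) < r.
  rewrite addrAC subrr add0r (normB_Z bT) (rabs_emb rs (ltW c0)).
  have -> : c * NT t = r / 2 by rewrite /c; field; rewrite gt_eqF.
  by rewrite ltr_pdivrMr// ltr_pMr// ltr1n.
have [z1 [s1 Ns1 hs1] hz1] := Ax _ yr _ r8.
have [z2 [s2 Ns2 hs2] hz2] := Ax x xr _ r8.
have cV0 : 0 <= c^-1 by rewrite invr_ge0 ltW.
have cV : emb c^-1 * emb c = 1 by rewrite -rmorphM mulVf ?gt_eqF// rmorph1.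
exists (emb c^-1 *: (z1 - z2)), (emb c^-1 *: (s1 - s2)); split.
- by rewrite !linearZ !linearB hs1 hs2.
- rewrite (normB_Z (bS m)) (rabs_emb rs cV0).
  have -> : 4 * i%:R / r * NT t = c^-1 * (2 * i%:R).
    by rewrite /c; field; rewrite !gt_eqF.
  rewrite ler_wpM2l//; apply: le_trans (normB_D (bS m) _ _) _.
  by rewrite (normB_N (bS m)) mulr2n mulrDl mul1r lerD.
have -> : t - emb c^-1 *: (z1 - z2) = emb c^-1 *: ((x + emb c *: t - z1) - (x - z2)).
  have -> (a : T) : x + a - z1 - (x - z2) = a - (z1 - z2).
    rewrite [x + a]addrC -[a + x - z1]addrA -[LHS]addrA !opprB.
    by rewrite [x - z1 + _]addrC subrKA.
  by rewrite [in RHS]scalerBr scalerA cV scale1r.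
rewrite (normB_Z bT) (rabs_emb rs cV0).
have -> : NT t / 2 = c^-1 * (r / 4) by rewrite /c; field; rewrite !gt_eqF.
rewrite ler_wpM2l//; apply: le_trans (normB_D bT _ _) _.
by rewrite (normB_N bT); lra.
Qed.

(** As in the open mapping theorem, approximate lifting is iterated on the remainders [tn], whose
    norm bounds halve each time; the sums [sn] of the lifts converge in the single step m. *)
Lemma bounded_selection : exists m (C : R), 0 <= C /\ forall t, exists s,
  beta m s = alpha t /\ NS s <= C * NT t.
Proof.
have [m [K [K0 hK]]] := approx; exists m, (2 * K); split; first by rewrite mulr_ge0.
move=> t.
have ex (y : T) : exists zs : T * S m, [/\ beta m zs.2 = alpha zs.1,
    NS zs.2 <= K * NT y & NT (y - zs.1) <= NT y / 2].
  by have [z [s h]] := hK y; exists (z, s).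
have [F hF] := choice ex.
pose tn := fix tn n := if n is n'.+1 then tn n' - (F (tn n')).1 else t.
pose sn := fix sn n := if n is n'.+1 then sn n' + (F (tn n')).2 else 0.
have Nt n : NT (tn n) <= NT t * geo n.
  elim: n => [|n IH]; first by rewrite geo0 mulr1.
  have [_ _ h] := hF (tn n); apply: le_trans h _.
  by rewrite geoS mulrA ler_pM2r ?invr_gt0.
have hs n : NS (sn n.+1 - sn n) <= (K * NT t) * geo n.
  rewrite /= [sn n + _]addrC addrK; have [_ h _] := hF (tn n).
  by apply: le_trans h _; rewrite -mulrA ler_wpM2l.
have bs n : beta m (sn n) = alpha t - alpha (tn n).
  elim: n => [|n IH]; first by rewrite subrr linear0.
  have [h _ _] := hF (tn n).
  have -> : sn n.+1 = sn n + (F (tn n)).2 by [].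
  have -> : tn n.+1 = tn n - (F (tn n)).1 by [].
  by rewrite [LHS]linearD IH h [in RHS]linearB opprB addrA addrAC.
have [s [M hl]] := normB_complete (bS m) hs.
exists s; split; last first.
  by have := normB_fast_bound (bS m) hs hl; rewrite /= subr0 mulrA.
(* The defect is [beta m (s - sn n)] minus [alpha (tn n)] for every n. Both terms tend to 0, so it
   vanishes in the Hausdorff space [Y]. *)
apply/eqP; rewrite -subr_eq0; apply/eqP/(hausdorff_eq0 Yhaus) => U /nbhs0_half[W W0 WU].
have W0' : nbhs 0 (-%R @` W) by exact: nbhs0N.
have [r r0 hr] := @betac m _ W0; have [d d0 hd] := alphac W0'.
have [n1 hn1] := geo_small M r0; have [n2 hn2] := geo_small (NT t) d0.
pose n := maxn n1 n2.
have -> : beta m s - alpha t = beta m (s - sn n) + - alpha (tn n).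
  by rewrite [in RHS]linearB bs -addrA -opprD subrK.
apply: WU.
  by apply: hr; apply: le_lt_trans (hl n) _; apply: hn1; rewrite leq_maxl.
have [|w Ww <-] := hd (tn n); last by rewrite opprK.
by apply: le_lt_trans (Nt n) _; apply: hn2; rewrite leq_maxr.
Qed.

End Statement.
End Selection.

(** * Closed graph theorem and kernels *)

Section Objects.
Variables (R : realType) (k : numFieldType) (rs : rscalars R k).
Local Notation abs := (rabs rs).
Local Notation emb := (remb rs).

Lemma ncont_into (E : lmodType k) (P : pres rs E) (W : lmodType k) (NW : W -> R)
    n (g : W -> step P n) (C : R) : 0 <= C ->
  (forall w, stepN (g w) <= C * NW w) ->
  ncont NW (fun w => step_map P n (g w) : finT P).
Proof.
move=> C0 hC U; rewrite finT_nbhs0 => -[W' [WU aW /(_ n)[r r0 hr]]].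
exists (r / (C + 1)); first by rewrite divr_gt0// ltr_wpDl.
have C1 : 0 < C + 1 by rewrite ltr_wpDl.
move=> w; rewrite ltr_pdivlMr// mulrDr mulr1 => h; apply/WU/hr.
apply: le_lt_trans (hC w) _.
have [w0|w0] := leP 0 (NW w); first by apply: le_lt_trans h; rewrite mulrC lerDl.
by apply: le_lt_trans r0; rewrite mulr_ge0_le0// ltW.
Qed.

(* Closed graph theorem: a linear map [h] into a space presented by Banach
   spaces is continuous as soon as its composite with a continuous injection is. *)
Lemma ncont_factor (E : lmodType k) (P : pres rs E) (A : tvsType k) (i : E -> A)
    (T : lmodType k) (NT : T -> R) (g : T -> A) (h : T -> E) :
  hausdorff_space A -> linear i -> injective i ->
  (forall n, ncont (@stepN _ _ _ _ P n) (i \o step_map P n)) ->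
  banach rs NT -> linear g -> ncont NT g -> (forall t, i (h t) = g t) ->
  ncont NT (h : T -> finT P).
Proof.
move=> hA il ii ic bT gl gc ig.
have bl n : linear (i \o step_map P n) by move=> a x y; rewrite /= linearP il.
have [|m [C [C0 hC]]] := @bounded_selection R k rs T NT bT (step P)
    (@stepN _ _ _ _ P) (step_banach P) A (mklin gl) (fun n => mklin (bl n))
    hA gc ic.
  move=> t; have [n [s hs]] := step_cover P (h t); exists n, s.
  by rewrite /= hs ig.
move=> U /(ncont_into (P := P) (W := step P m) (NW := @stepN _ _ _ _ P m)
  (g := id) ler01)[|r r0 hr]; first by move=> w; rewrite mul1r.
have C1 : 0 < C + 1 by rewrite ltr_wpDl.
exists (r / (C + 1)); first by rewrite divr_gt0.
move=> t; rewrite ltr_pdivlMr// mulrDr mulr1 => ht.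
have [s [st Ns]] := hC t.
have <- : step_map P m s = h t by apply: ii; rewrite ig.
apply: hr; apply: le_lt_trans Ns _; apply: le_lt_trans ht.
by rewrite mulrC lerDl (normB_ge0 bT).
Qed.

Lemma lcfun_ext (A B : tvsType k) (f g : lcfun A B) : f =1 g -> f = g.
Proof. by move=> fg; apply: val_inj; apply/funext. Qed.

Lemma mkmor_subproof (A B : tvsType k) (f : A -> B) : linear f -> continuous f ->
  f \in @lcfun_pred k A B.
Proof. by move=> fl fc; apply/asboolP. Qed.

Definition mkmor (A B : tvsType k) (f : A -> B) (fl : linear f)
  (fc : continuous f) : lcfun A B := LCFun (mkmor_subproof fl fc).

Lemma LB_hausdorff (A : LBspace k) : hausdorff_space A.
Proof. by case: A => A []. Qed.

Section SubBanach.
Variables (V : lmodType k) (N : V -> R) (bN : banach rs N).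
Variables (Y : tvsType k) (Yh : hausdorff_space Y) (g : V -> Y).
Hypotheses (gl : linear g) (gc : ncont N g).

Lemma kernel_subspace (U : lmodType k) (W : lmodType k) (f : U -> W) :
  linear f -> lsubspace [set x | f x = 0].
Proof.
move=> fl; split; first exact: linear_fun0.
by move=> a x y /= fx fy; rewrite fl fx fy scaler0 addr0.
Qed.

(** Limits stay in the kernel, which is closed since [g] is continuous into a Hausdorff space. *)
Lemma kernel_banach : banach rs (fun x : subT (kernel_subspace gl) => N x).
Proof.
split.
- by move=> x y; exact: (normB_D bN).
- by move=> a x; exact: (normB_Z bN).
- by move=> x /(normB_eq0 bN) x0; apply: subT_inj.
move=> u C hu; have [l [M hl]] := normB_complete bN (u := fun n => subT_val (u n)) hu.
suff gl0 : g l = 0 by exists (subT_mk (kernel_subspace gl) gl0), M => n; exact: hl.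
apply: (hausdorff_eq0 Yh) => U U0; have [r r0 hr] := gc U0.
have [n hn] := geo_small M r0.
have -> : g l = g (l - subT_val (u n)).
  by rewrite (linear_funB _ _ gl) (subTP (u n)) subr0.
by apply: hr; apply: le_lt_trans (hl n) (hn n _).
Qed.
End SubBanach.

Section Kernel.
Variables (A B : LBspace k) (f : lcfun A B).
Variables (P : pres rs A) (hP : presents P).

Let K : lmodType k := subT (kernel_subspace (lcfun_linear f)).

Let fj_linear n : linear (f \o step_map P n).
Proof. by move=> a x y; rewrite /= !linearP. Qed.

Let fj_ncont n : ncont (@stepN _ _ _ _ P n) (f \o step_map P n).
Proof. by apply: (pres_ncont hP); [exact: lcfun_linear|exact: lcfun_continuous]. Qed.

Let S n : lmodType k := subT (kernel_subspace (@fj_linear n)).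
Let NS n (x : S n) : R := stepN (subT_val x).
Let bS n : banach rs (@NS n) :=
  kernel_banach (step_banach P n) (@LB_hausdorff B) (@fj_linear n) (@fj_ncont n).
Let jS n (x : S n) : K := subT_mk (kernel_subspace (lcfun_linear f)) (subTP x).
Let jSl n : linear (@jS n).
Proof. by move=> a x y; apply: subT_inj; rewrite linearP /= linearP. Qed.

Let jS_cover (y : K) : exists n x, mklin (@jSl n) x = y.
Proof.
have [n [x hx]] := step_cover P (subT_val y).
have fx : (f \o step_map P n) x = 0 by rewrite /= hx (subTP y).
by exists n, (subT_mk (kernel_subspace (@fj_linear n)) fx); apply: subT_inj.
Qed.

Let jS_nested n : exists C : R, forall x : S n, exists x' : S n.+1,
  mklin (@jSl n.+1) x' = mklin (@jSl n) x /\ NS x' <= C * NS x.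
Proof.
have [C hC] := step_nested P n; exists C => x.
have [x' [h1 h2]] := hC (subT_val x).
have fx : (f \o step_map P n.+1) x' = 0 by rewrite /= h1; exact: subTP x.
by exists (subT_mk (kernel_subspace (@fj_linear n.+1)) fx); split=> //; exact: subT_inj.
Qed.

Definition ker_pres : pres rs K := Pres bS jS_cover jS_nested.

Let incl_ncont n :
  ncont (@stepN _ _ _ _ ker_pres n) ((subT_val : K -> A) \o step_map ker_pres n).
Proof.
by move=> U /(@step_ncont _ _ _ _ P n hP)[r r0 hr]; exists r => // s /hr.
Qed.

Let sepK : point_separated ker_pres.
Proof.
move=> v v0; exists A, (fun x : K => subT_val x); split=> //.
- exact: LB_hausdorff.
- by move=> vv; apply: v0; apply: subT_inj.
Qed.

Let Kob : LBspace k := mkLB sepK.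

Let il : linear ((fun x : K => subT_val x) : Kob -> A).
Proof. by []. Qed.

Let ic : continuous ((fun x : K => subT_val x) : Kob -> A).
Proof.
exact: (pres_continuous (P := fin_pres ker_pres) (@fin_presents _ _ _ _ _) il
  incl_ncont).
Qed.

(** The topology of [Kob] may be finer than the induced one, so continuity of a factorization is not
    automatic; it follows from the closed graph theorem [ncont_factor] on each step of the
    source. *)
Lemma LB_kernel : exists (K : LB k) (i : mor K A), kernel_of (C := LB k) f i.
Proof.
exists Kob, (mkmor il ic); split.
  by apply: lcfun_ext => x; exact: (subTP (x : K)).
move=> X g fg.
have fgx x : f (g x) = 0 by have := congr1 (fun h : lcfun X B => h x) fg.
pose h (x : X) : Kob := subT_mk (kernel_subspace (lcfun_linear f)) (fgx x).
have hl : linear h by move=> a x y; apply: subT_inj; rewrite /= linearP.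
have [PX hX] := LB_presents rs X.
have hc : continuous h.
  apply: (pres_continuous hX hl) => n.
  apply: (@ncont_factor K ker_pres A (fun x => subT_val x) _ _
    (g \o step_map PX n) (h \o step_map PX n)) => //.
  - exact: LB_hausdorff.
  - exact: subT_inj.
  - exact: step_banach.
  - by move=> a x y; rewrite /= !linearP.
  - by apply: (pres_ncont hX); [exact: lcfun_linear|exact: lcfun_continuous].
exists (mkmor hl hc); split; first by apply: lcfun_ext.
move=> h' ih'; apply: lcfun_ext => x; apply: subT_inj.
by have := congr1 (fun u : lcfun X A => u x) ih' => /= ->.
Qed.

End Kernel.
End Objects.

(** * Cokernels, biproducts and left quasi-abelianity *)

Section LeftQuasiAbelian.
Variables (R : realType) (k : numFieldType) (rs : rscalars R k).
Local Notation abs := (rabs rs).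
Local Notation emb := (remb rs).

Section Banach.
Variables (V : lmodType k) (N : V -> R) (bN : banach rs N).

Let idl : linear (id : V -> V). Proof. by []. Qed.

Let const_cover (y : V) : exists (n : nat) x, mklin idl x = y.
Proof. by exists 0%N, y. Qed.

Let const_nested (n : nat) : exists C : R, forall x : V, exists x' : V,
  mklin idl x' = mklin idl x /\ N x' <= C * N x.
Proof. by exists 1 => x; exists x; rewrite mul1r. Qed.

Definition const_pres : pres rs V :=
  @Pres R k rs V (fun=> V) (fun=> N) (fun=> bN) (fun=> mklin idl)
    const_cover const_nested.

Let const_sep : point_separated const_pres.
Proof.
move=> v v0; exists (bnT bN), id; split=> // n U /bnT_nbhs0 h; exact: h.
Qed.

Definition banachLB : LBspace k := mkLB const_sep.

Lemma banachLB_continuous (B : tvsType k) (g : V -> B) :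
  linear g -> ncont N g -> continuous (g : banachLB -> B).
Proof.
by move=> gl gc; apply: (pres_continuous (P := fin_pres const_pres)
  (@fin_presents _ _ _ _ _) gl).
Qed.

Lemma ncont_banachLB (W : lmodType k) (NW : W -> R) (g : W -> V) (C : R) :
  0 <= C -> (forall w, N (g w) <= C * NW w) ->
  ncont NW (g : W -> banachLB).
Proof. exact: (@ncont_into _ _ _ _ const_pres _ _ 0%N). Qed.

Lemma banachLB_ncont (B : LBspace k) (g : lcfun banachLB B) :
  ncont N (g : V -> B).
Proof.
apply: (@pres_ncont _ _ _ _ (fin_pres const_pres) _ g (@fin_presents _ _ _ _ _) _ _ 0%N).
  exact: lcfun_linear.
exact: lcfun_continuous.
Qed.

End Banach.

Lemma scalar_banach : banach rs (abs : k^o -> R).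
Proof.
split.
- exact: rabsD.
- exact: rabsM.
- exact: rabs_eq0.
exact: rabs_complete.
Qed.

Definition scalarLB : LBspace k := banachLB scalar_banach.

(** Turns points into morphisms, so that universal properties can be tested on points. Continuity
    holds because [b] lifts to some step. *)
Lemma scalarLB_point (B : LBspace k) (b : B) :
  exists g : lcfun scalarLB B, forall a : k, g a = a *: b.
Proof.
have [P hP] := LB_presents rs B.
have gl : linear (fun a : k^o => a *: b).
  by move=> a x y; rewrite scalerDl scalerA.
have gc : ncont abs (fun a : k^o => a *: b).
  move=> U /hP[W [WU aW hW]].
  have [n [s sb]] := step_cover P b; have [r r0 hr] := hW n.
  have N1 : 0 < stepN s + 1 by rewrite ltr_wpDl ?(normB_ge0 (step_banach P n)).
  exists (r / (stepN s + 1)); first by rewrite divr_gt0.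
  move=> a; rewrite ltr_pdivlMr// mulrDr mulr1 => ar.
  rewrite -sb -[_ *: step_map P n s]linearZ; apply/WU/hr.
  by rewrite (normB_Z (step_banach P n)); apply: le_lt_trans ar; rewrite lerDl rabs_ge0.
by exists (mkmor (A := scalarLB) gl (banachLB_continuous gl gc)).
Qed.

Section Quotient.
Variables (E : lmodType k) (Q : set E) (hQ : lsubspace Q).

Lemma quot_factor (F : lmodType k) (g : E -> F) : linear g ->
  (forall x, Q x -> g x = 0) ->
  exists2 h : quotT hQ -> F, linear h & forall x, h (quot_pi hQ x) = g x.
Proof.
move=> gl gQ; have [s hs] := choice (quot_pi_surj (hQ := hQ)).
have hE x : g (s (quot_pi hQ x)) = g x.
  apply/eqP; rewrite -subr_eq0 -(linear_funB _ _ gl); apply/eqP/gQ.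
  by apply/(quot_piP hQ).
exists (g \o s) => [a p q|x]; last exact: hE.
have [x <-] := quot_pi_surj p; have [y <-] := quot_pi_surj q.
by rewrite -linearP /= !hE gl.
Qed.

End Quotient.

Section Cokernel.
Variables (A B : LBspace k) (f : lcfun A B) (P : pres rs B) (hP : presents P).

(** This stands in for the closure of the range of [f]. A point outside it is detected by some
    morphism that factors through the quotient, which is thus Hausdorff by construction. *)
Let W : set B := [set x | forall (X : LBspace k) (g : lcfun B X),
  (forall a, g (f a) = 0) -> g x = 0].

Let hW : lsubspace W.
Proof.
split=> [X g _|a x y hx hy X g hg]; first by rewrite linear0.
by rewrite (lcfun_linear g) (hx X g hg) (hy X g hg) scaler0 addr0.
Qed.

Let Q : lmodType k := quotT hW.
Let pj_linear n : linear (quot_pi hW \o step_map P n).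
Proof. by move=> a x y; rewrite /= !linearP. Qed.

Let pj_cover (q : Q) : exists n x, mklin (@pj_linear n) x = q.
Proof.
have [b <-] := quot_pi_surj q; have [n [x <-]] := step_cover P b.
by exists n, x.
Qed.

Let pj_nested n : exists C : R, forall x, exists x',
  mklin (@pj_linear n.+1) x' = mklin (@pj_linear n) x /\ stepN x' <= C * stepN x.
Proof.
have [C hC] := step_nested P n; exists C => x; have [x' [h1 h2]] := hC x.
by exists x'; rewrite /= h1.
Qed.

Definition coker_pres : pres rs Q := Pres (step_banach P) pj_cover pj_nested.

Let factor (X : LBspace k) (g : lcfun B X) : (forall a, g (f a) = 0) ->
  exists h : Q -> X, [/\ linear h, (forall x, h (quot_pi hW x) = g x) &
    forall n, ncont (@stepN _ _ _ _ coker_pres n) (h \o step_map coker_pres n)].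
Proof.
move=> gf; have [|h hl hg] := quot_factor hW (lcfun_linear g).
  by move=> x; apply.
exists h; split=> // n.
have -> : h \o step_map coker_pres n = g \o step_map P n.
  by apply/funext => x; exact: hg.
by apply: (pres_ncont hP); [exact: lcfun_linear|exact: lcfun_continuous].
Qed.

Let coker_sep : point_separated coker_pres.
Proof.
move=> v v0; have [x xv] := quot_pi_surj v.
have : ~ W x.
  move=> Wx; apply: v0; rewrite -xv -(linear0 (quot_pi hW)).
  by apply/(quot_piP hW); rewrite subr0.
move=> /existsNP[X /existsNP[g /not_implyP[gf gx]]].
have [h [hl hg hc]] := factor gf.
exists X, h; split=> //; first exact: LB_hausdorff.
by rewrite -xv hg.
Qed.

Let Qob : LBspace k := mkLB coker_sep.

(** Surjectivity is recorded because every other cokernel inherits it by uniqueness. *)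
Lemma LB_cokernel_surj : exists (Q : LB k) (p : @mor (LB k) B Q),
  cokernel_of (C := LB k) f p /\
  forall q : (Q : LBspace k), exists x, (p : lcfun B (Q : LBspace k)) x = q.
Proof.
have pc : continuous (quot_pi hW : B -> Qob).
  apply: (pres_continuous hP); first exact: quot_pi_linear.
  move=> n.
  have := @step_ncont _ _ _ _ (fin_pres coker_pres) n (@fin_presents _ _ _ _ _).
  by [].
have pl : linear (quot_pi hW : B -> Qob) by exact: quot_pi_linear.
exists Qob, (mkmor pl pc); split; last exact: quot_pi_surj.
split.
  apply: lcfun_ext => a.
  have Wfa : W (f a) by move=> X g; exact.
  apply: (etrans _ (linear0 (quot_pi hW))).
  by apply/(quot_piP hW); rewrite subr0.
move=> X g gf.
have gf' a : g (f a) = 0 by have := congr1 (fun h : lcfun A X => h a) gf.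
have [h [hl hg hc]] := factor gf'.
have hcont : continuous (h : Qob -> X).
  exact: (pres_continuous (P := fin_pres coker_pres) (@fin_presents _ _ _ _ _) hl).
exists (mkmor (A := Qob) hl hcont); split; first by apply: lcfun_ext => x; exact: hg.
move=> h' hh'; apply: lcfun_ext => q; have [x <-] := quot_pi_surj (q : Q).
by rewrite /= hg -hh'.
Qed.

End Cokernel.

Section Biproduct.
Variables (A B : LBspace k) (P : pres rs A) (Q : pres rs B).
Hypotheses (hP : presents P) (hQ : presents Q).

Let E : lmodType k := (A * B)%type.
Let S n : lmodType k := (step P n * step Q n)%type.
Let NS n (x : S n) : R := stepN x.1 + stepN x.2.

Let bS n : banach rs (@NS n).
Proof.
have bP := step_banach P n; have bQ := step_banach Q n.
split.
- by move=> x y; rewrite /NS addrACA; apply: lerD; [exact: (normB_D bP)|exact: (normB_D bQ)].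
- by move=> a x; rewrite /NS mulrDr (normB_Z bP) (normB_Z bQ).
- move=> [x y] /eqP; rewrite /NS paddr_eq0 ?(normB_ge0 bP) ?(normB_ge0 bQ)//=.
  by move=> /andP[/eqP/(normB_eq0 bP)-> /eqP/(normB_eq0 bQ)->].
move=> u C hu.
have [|l1 [M1 h1]] := normB_complete bP (u := fun n => (u n).1) (C := C).
  by move=> i; apply: le_trans (hu i); rewrite lerDl (normB_ge0 bQ).
have [|l2 [M2 h2]] := normB_complete bQ (u := fun n => (u n).2) (C := C).
  by move=> i; apply: le_trans (hu i); rewrite lerDr (normB_ge0 bP).
by exists (l1, l2), (M1 + M2) => i; rewrite mulrDl; apply: lerD; [exact: h1|exact: h2].
Qed.

Let jS n (x : S n) : E := (step_map P n x.1, step_map Q n x.2).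
Let jSl n : linear (@jS n).
Proof. by move=> a x y; rewrite /jS /= !linearP. Qed.

(** Iterated nesting brings points covered by different steps of the two factors to a common
    step. *)
Let nestedn (X : LBspace k) (P' : pres rs X) n m : exists2 C : R, 0 <= C &
  forall x, exists x', step_map P' (m + n) x' = step_map P' n x /\
    stepN x' <= C * stepN x.
Proof.
elim: m => [|m [C C0 IH]].
  by exists 1 => // x; exists x; rewrite mul1r.
have [D hD] := step_nested P' (m + n); exists (`|D| * C); first by rewrite mulr_ge0.
move=> x; have [y [y1 y2]] := IH x; have [z [z1 z2]] := hD y.
exists z; split; first by rewrite z1.
apply: le_trans z2 _; rewrite -mulrA; apply: (@le_trans _ _ (`|D| * stepN y)).
  by rewrite ler_wpM2r ?ler_norm// (normB_ge0 (step_banach P' _)).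
by rewrite ler_wpM2l.
Qed.

Let cover_at (X : LBspace k) (P' : pres rs X) x n m s :
  (n <= m)%N -> step_map P' n s = x -> exists s', step_map P' m s' = x.
Proof.
move=> nm <-; rewrite -(subnK nm); have [C _ hC] := nestedn P' n (m - n).
by have [s' [h _]] := hC s; exists s'.
Qed.

Let prod_cover (y : E) : exists n x, mklin (@jSl n) x = y.
Proof.
case: y => a b; have [n [s sa]] := step_cover P a; have [m [t tb]] := step_cover Q b.
have [s' sa'] := cover_at (leq_maxl n m) sa.
have [t' tb'] := cover_at (leq_maxr n m) tb.
by exists (maxn n m), (s', t'); rewrite /= /jS /= sa' tb'.
Qed.

Let prod_nested n : exists C : R, forall x, exists x',
  mklin (@jSl n.+1) x' = mklin (@jSl n) x /\ NS x' <= C * NS x.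
Proof.
have [C C0 hC] := nestedn P n 1; have [D D0 hD] := nestedn Q n 1.
exists (C + D) => -[x y].
have [x' [x1 x2]] := hC x; have [y' [y1 y2]] := hD y.
exists (x', y'); split; first by rewrite /= /jS /= x1 y1.
have Nx := normB_ge0 (step_banach P n) x; have Ny := normB_ge0 (step_banach Q n) y.
by apply: le_trans (lerD x2 y2) _; rewrite /NS /=; nra.
Qed.

Definition prod_pres : pres rs E := Pres bS prod_cover prod_nested.

Let fst_linear : linear (fst : E -> A). Proof. by []. Qed.
Let snd_linear : linear (snd : E -> B). Proof. by []. Qed.

Let fst_ncont n : ncont (@stepN _ _ _ _ prod_pres n) (fst \o step_map prod_pres n).
Proof.
move=> U /(@step_ncont _ _ _ _ P n hP)[r r0 hr]; exists r => // s sr; apply: hr.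
by apply: le_lt_trans sr; rewrite /= lerDl (normB_ge0 (step_banach Q n)).
Qed.

Let snd_ncont n : ncont (@stepN _ _ _ _ prod_pres n) (snd \o step_map prod_pres n).
Proof.
move=> U /(@step_ncont _ _ _ _ Q n hQ)[r r0 hr]; exists r => // s sr; apply: hr.
by apply: le_lt_trans sr; rewrite /= lerDr (normB_ge0 (step_banach P n)).
Qed.

Let prod_sep : point_separated prod_pres.
Proof.
case=> a b ab; have [a0|a0] := pselect (a = 0).
  exists B, snd; split=> //; first exact: LB_hausdorff.
  by move=> /= b0; apply: ab; rewrite a0 b0.
by exists A, fst; split=> //; exact: LB_hausdorff.
Qed.

Let Pob : LBspace k := mkLB prod_sep.

Let inl_linear : linear ((fun a => (a, 0)) : A -> Pob).
Proof.
move=> a x y; have e : 0 = a *: 0 + 0 :> B by rewrite scaler0 addr0.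
exact: (congr1 (pair (a *: x + y)) e).
Qed.

Let inr_linear : linear ((fun b => (0, b)) : B -> Pob).
Proof.
move=> a x y; have e : 0 = a *: 0 + 0 :> A by rewrite scaler0 addr0.
exact: (congr1 (pair^~ (a *: x + y)) e).
Qed.

Let inl_cont : continuous ((fun a => (a, 0)) : A -> Pob).
Proof.
apply: (pres_continuous hP) => // n.
have -> : (fun a => (a, 0)) \o step_map P n =
    (fun x => step_map prod_pres n (x, 0)) :> (_ -> Pob).
  by apply/funext => x; rewrite /= /jS linear0.
apply: (ncont_into (C := 1)) => // x.
by rewrite mul1r /= /NS /= (normB0 (step_banach Q n)) addr0.
Qed.

Let inr_cont : continuous ((fun b => (0, b)) : B -> Pob).
Proof.
apply: (pres_continuous hQ) => // n.
have -> : (fun b => (0, b)) \o step_map Q n =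
    (fun x => step_map prod_pres n (0, x)) :> (_ -> Pob).
  by apply/funext => x; rewrite /= /jS linear0.
apply: (ncont_into (C := 1)) => // x.
by rewrite mul1r /= /NS /= (normB0 (step_banach P n)) add0r.
Qed.

Let fst_cont : continuous (fst : Pob -> A).
Proof. exact: (pres_continuous (P := fin_pres prod_pres) (@fin_presents _ _ _ _ _)). Qed.

Let snd_cont : continuous (snd : Pob -> B).
Proof. exact: (pres_continuous (P := fin_pres prod_pres) (@fin_presents _ _ _ _ _)). Qed.

Lemma LB_biproduct_ex : exists (P : LB k) iA iB pA pB,
  biproduct (C := LB k) (A := A) (B := B) (P := P) iA iB pA pB.
Proof.
exists Pob, (mkmor inl_linear inl_cont), (mkmor inr_linear inr_cont).
exists (mkmor (A := Pob) fst_linear fst_cont), (mkmor (A := Pob) snd_linear snd_cont).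
split; apply: lcfun_ext => //= -[a b].
by congr (_, _); rewrite ?addr0 ?add0r.
Qed.

End Biproduct.

(** The kernel of an identity map: its inclusion is 0, hence so is its own identity, by uniqueness
    of factorizations. *)
Lemma LB_zero : exists Z : LB k, zero_object Z.
Proof.
have [P hP] := LB_presents rs scalarLB.
have [Z [i [i0 hi]]] := LB_kernel (lcfun_id scalarLB) hP.
have {}i0 : i = 0 :> lcfun Z scalarLB by rewrite -i0; exact/esym/LB_comp1m.
exists Z => A; split.
  have [|h [_ hu]] := hi A (0 : lcfun A scalarLB); first by apply: lcfun_ext.
  exists h; split=> // h' _; apply: hu.
  by rewrite i0; apply: lcfun_ext.
have idZ : lcfun_id Z = 0 :> lcfun Z Z.
  have [|h [_ hu]] := hi Z (0 : lcfun Z scalarLB); first by apply: lcfun_ext.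
  by rewrite -(hu (lcfun_id Z)) ?(hu 0)// i0; exact: lcfun_ext.
exists (0 : lcfun Z A); split=> // f _.
rewrite -[RHS](LB_compm1 (f : lcfun Z A)) idZ; apply: lcfun_ext => x.
by rewrite /= linear0.
Qed.

Lemma LB_pre_abelian : pre_abelian (LB k).
Proof.
split; first split; first exact: LB_zero.
  move=> A B; have [P hP] := LB_presents rs A; have [Q hQ] := LB_presents rs B.
  exact: LB_biproduct_ex hP hQ.
move=> A B f; have [P hP] := LB_presents rs A; have [Q hQ] := LB_presents rs B.
split; first exact: (LB_kernel (f : lcfun A B) hP).
by have [Q' [p [hp _]]] := LB_cokernel_surj (f : lcfun A B) hQ; exists Q', p.
Qed.

(** Comparing [d] with the surjective cokernel [p] of the same map gives h d = p, h' p = d and h' h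
    = 1. A point over h y is then sent to y by [d]. *)
Lemma LB_cokernel_is_surj (B D : LB k) (d : mor B D) : is_cokernel d ->
  forall y : (D : LBspace k), exists x, (d : lcfun B D) x = y.
Proof.
move=> [A [f [df dU]]] y; have [P hP] := LB_presents rs B.
have [Q [p [[pf pU] ps]]] := LB_cokernel_surj (f : lcfun A B) hP.
have [h [hd _]] := dU _ _ pf; have [h' [hp _]] := pU _ _ df.
have hh : mcomp h' h = idmor D.
  have [u [_ uu]] := dU _ _ df.
  rewrite -(uu (mcomp h' h)); last by rewrite -Defs.compA hd hp.
  by rewrite -(uu (idmor D))// comp1m.
have [x xp] := ps ((h : lcfun D Q) y); exists x.
rewrite -hp /= xp.
by have := congr1 (fun u : lcfun D D => u y) hh.
Qed.

(** The map [a] is the cokernel of its kernel. The factorization [h] uses arbitrary preimages; it is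
    continuous because the points of each step of [B] have preimages in one step of [A] with a norm
    bound. *)
Lemma LB_surj_is_cokernel (A B : LB k) (a : mor A B) :
  (forall y : (B : LBspace k), exists x, (a : lcfun A B) x = y) -> is_cokernel a.
Proof.
move=> asurj; have [P hP] := LB_presents rs A.
have [K [i [ai iU]]] := LB_kernel (a : lcfun A B) hP.
exists K, i; split=> // X g gi.
(* A point killed by [a] is a morphism from the scalars that factors through [i], hence is killed by
   [g]. *)
have gker x : (a : lcfun A B) x = 0 -> (g : lcfun A X) x = 0.
  move=> ax; have [pt hpt] := scalarLB_point (x : (A : LBspace k)).
  have [|h [ih _]] := iU scalarLB pt.
    by apply: lcfun_ext => c; rewrite /= hpt linearZ /= ax scaler0.
  have := congr1 (fun u : lcfun scalarLB A => u 1) ih; rewrite hpt scale1r => <- /=.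
  exact: (congr1 (fun u : lcfun K X => u ((h : lcfun scalarLB K) 1)) gi).
have [s hs] := choice asurj.
pose h (y : (B : LBspace k)) := (g : lcfun A X) (s y).
have ha x : h ((a : lcfun A B) x) = (g : lcfun A X) x.
  apply/eqP; rewrite -subr_eq0 -linearB; apply/eqP/gker.
  by rewrite (linear_funB _ _ (lcfun_linear _)) hs subrr.
have hl : linear h.
  by move=> c x y; rewrite -[in LHS](hs x) -[in LHS](hs y) -(lcfun_linear a) ha (lcfun_linear g).
have [PB hB] := LB_presents rs B.
have al : forall n, linear ((a : lcfun A B) \o step_map P n).
  by move=> n c x y; rewrite /= !linearP.
have hc : continuous h.
  apply: (pres_continuous hB hl) => n.
  have [|m [C [C0 hC]]] := @bounded_selection R k rs _ _ (step_banach PB n)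
     (step P) (@stepN _ _ _ _ P) (step_banach P) _ (step_map PB n)
     (fun n => mklin (al n)) (@LB_hausdorff k B) (@step_ncont _ _ _ _ PB n hB)
     (@pres_ncont _ _ _ _ _ _ _ hP (lcfun_linear a) (@lcfun_continuous _ _ _ a)).
    move=> t; have [x ax] := asurj (step_map PB n t).
    by have [m [s' sx]] := step_cover P x; exists m, s'; rewrite /= sx.
  move=> U U0.
  have [r r0 hr] : exists2 r : R, 0 < r & forall s', stepN s' < r ->
      U ((g : lcfun A X) (step_map P m s')).
    by apply: (pres_ncont hP) U0; [exact: lcfun_linear|exact: lcfun_continuous].
  have C1 : 0 < C + 1 by rewrite ltr_wpDl.
  exists (r / (C + 1)); first by rewrite divr_gt0.
  move=> t; rewrite ltr_pdivlMr// mulrDr mulr1 => tr.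
  have [s' [st Ns]] := hC t; rewrite /= -st /= ha; apply: hr.
  apply: le_lt_trans Ns _; apply: le_lt_trans tr.
  by rewrite mulrC lerDl (normB_ge0 (step_banach PB n)).
exists (mkmor hl hc); split; first by apply: lcfun_ext => x; exact: ha.
move=> h' hh'; apply: lcfun_ext => y; rewrite -[in RHS](hs y) /=.
by rewrite -[y in LHS]hs ha -hh'.
Qed.

(** A point y of [B] and a preimage under [d] of its image in [D] are compatible morphisms from the
    scalars, so the pullback has a point over y. *)
Lemma LB_left_quasi_abelian : left_quasi_abelian (LB k).
Proof.
split; first exact: LB_pre_abelian.
move=> A B E D a b c d [sq pb] /LB_cokernel_is_surj dsurj.
apply: LB_surj_is_cokernel => y.
have [x xy] := dsurj ((c : lcfun B D) y).
have [py hpy] := scalarLB_point (y : (B : LBspace k)).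
have [px hpx] := scalarLB_point (x : (E : LBspace k)).
have [|h [[ah _] _]] := pb scalarLB py px.
  by apply: lcfun_ext => t; rewrite /= hpy hpx !linearZ /= xy.
exists ((h : lcfun scalarLB A) 1).
have := congr1 (fun u : lcfun scalarLB B => u 1) ah.
by rewrite hpy scale1r.
Qed.

End LeftQuasiAbelian.

(** * The Banach space l^1 *)

Section SummableSequences.
Variables (R : realType) (k : numFieldType) (rs : rscalars R k).
Local Notation abs := (rabs rs).
Local Notation emb := (remb rs).

Definition abs_psum (x : nat -> k) n : R := \sum_(i < n) abs (x i).

Lemma abs_psumS x n : abs_psum x n.+1 = abs_psum x n + abs (x n).
Proof. by rewrite /abs_psum big_ord_recr. Qed.

Lemma abs_psum_ge0 x n : 0 <= abs_psum x n.
Proof. by rewrite sumr_ge0// => i _; exact: rabs_ge0. Qed.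

Lemma abs_psum_mono x m n : (m <= n)%N -> abs_psum x m <= abs_psum x n.
Proof.
move=> mn; rewrite -(subnK mn); elim: (n - m)%N => // p IH.
by apply: le_trans IH _; rewrite addSn abs_psumS lerDl rabs_ge0.
Qed.

Lemma abs_psumD x y n :
  abs_psum (fun i => x i + y i) n <= abs_psum x n + abs_psum y n.
Proof. by rewrite -big_split; apply: ler_sum => i _; exact: rabsD. Qed.

Lemma abs_psumZ a x n : abs_psum (fun i => a * x i) n = abs a * abs_psum x n.
Proof. by rewrite /abs_psum mulr_sumr; apply: eq_bigr => i _; rewrite rabsM. Qed.

Definition abs_summable (x : nat -> k^o) := exists M, forall n, abs_psum x n <= M.

Lemma summable_lsubspace : lsubspace abs_summable.
Proof.
split.
  exists 0 => n; rewrite /abs_psum big1// => i _; exact: rabs0.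
move=> a x y [M hM] [M' hM']; exists (abs a * M + M') => n.
apply: le_trans (abs_psumD (fun i => a * x i) y n) _.
by rewrite lerD// abs_psumZ ler_wpM2l ?rabs_ge0.
Qed.

Definition l1 : lmodType k := subT summable_lsubspace.
Definition l1_mk (x : nat -> k^o) (hx : abs_summable x) : l1 :=
  subT_mk summable_lsubspace hx.
Definition coor (x : l1) (i : nat) : k := subT_val x i.
Arguments coor : simpl never.

Definition l1_norm (x : l1) : R := sup [set abs_psum (coor x) n | n in setT].

Lemma l1P (x y : l1) : (forall i, coor x i = coor y i) -> x = y.
Proof. by move=> xy; apply: subT_inj; apply/funext. Qed.

Lemma coorD (x y : l1) i : coor (x + y) i = coor x i + coor y i.
Proof. by []. Qed.

Lemma coorZ a (x : l1) i : coor (a *: x) i = a * coor x i.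
Proof. by []. Qed.

Lemma coorN (x : l1) i : coor (- x) i = - coor x i.
Proof. by rewrite -scaleN1r coorZ mulN1r. Qed.

Let sup_l1 (x : l1) : has_sup [set abs_psum (coor x) n | n in setT].
Proof.
split; first by exists (abs_psum (coor x) 0), 0%N.
by have [M hM] := subTP x; exists M => _ [n _ <-]; exact: hM.
Qed.

Lemma abs_psum_le_norm (x : l1) n : abs_psum (coor x) n <= l1_norm x.
Proof. by apply: sup_upper_bound; [exact: sup_l1|exists n]. Qed.

Lemma l1_norm_le (x : l1) M : (forall n, abs_psum (coor x) n <= M) ->
  l1_norm x <= M.
Proof.
move=> hM; apply: ge_sup; first by case: (sup_l1 x).
by move=> _ [n _ <-].
Qed.

Lemma l1_norm_approx (x : l1) e : 0 < e ->
  exists n, forall m, (n <= m)%N -> l1_norm x - e < abs_psum (coor x) m.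
Proof.
move=> e0; have [_ [n _ <-] hn] := sup_adherent e0 (sup_l1 x).
by exists n => m nm; apply: lt_le_trans hn (abs_psum_mono _ nm).
Qed.

Lemma coor_le_norm (x : l1) i : abs (coor x i) <= l1_norm x.
Proof.
apply: le_trans (abs_psum_le_norm x i.+1).
by rewrite abs_psumS lerDr abs_psum_ge0.
Qed.

Lemma l1_banach : banach rs l1_norm.
Proof.
have Zle a x : l1_norm (a *: x) <= abs a * l1_norm x.
  apply: l1_norm_le => n.
  have -> : abs_psum (coor (a *: x)) n = abs a * abs_psum (coor x) n.
    by rewrite -abs_psumZ; apply: eq_bigr => i _; rewrite coorZ.
  by rewrite ler_wpM2l ?rabs_ge0// abs_psum_le_norm.
split.
- move=> x y; apply: l1_norm_le => n.
  by apply: le_trans (abs_psumD (coor x) (coor y) n) _; rewrite lerD ?abs_psum_le_norm.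
- move=> a x; apply/eqP; rewrite eq_le Zle/=.
  have [->|a0] := eqVneq a 0.
    rewrite rabs0 mul0r; apply: le_trans (abs_psum_le_norm _ 0).
    exact: abs_psum_ge0.
  have := Zle a^-1 (a *: x); rewrite scalerA mulVf// scale1r rabsV.
  by rewrite mulrC ler_pdivlMr ?rabs_pos// mulrC.
- move=> x x0; apply: l1P => i; apply: (rabs_eq0 (rs := rs)); apply/eqP.
  by rewrite eq_le rabs_ge0 andbT -x0 coor_le_norm.
move=> u C hu.
have hi i n : abs (coor (u n.+1) i - coor (u n) i) <= C * geo n.
  apply: le_trans (hu n); rewrite -coorN -coorD; exact: coor_le_norm.
have [l hl] := choice (fun i => rabs_complete (hi i)).
have [M hM] := choice hl.
pose d p n i := coor (u p) i - coor (u n) i.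
have hd m n q : abs_psum (d (q + n)%N n) m <= 2 * C * geo n - 2 * C * geo (q + n).
  elim: q => [|q IH].
    rewrite add0n subrr /abs_psum big1// => i _.
    by rewrite /d subrr rabs0.
  have -> : abs_psum (d (q.+1 + n)%N n) m =
      abs_psum (fun i => coor (u (q + n).+1 - u (q + n)%N) i + d (q + n)%N n i) m.
    by congr abs_psum; apply/funext => i; rewrite /d coorD coorN addrA subrK.
  apply: le_trans (abs_psumD _ _ _) _.
  have := le_trans (abs_psum_le_norm (u (q + n).+1 - u (q + n)%N) m) (hu _).
  by rewrite addSn geoS; lra.
have C0 : 0 <= C.
  by have := le_trans (le_trans (rabs_ge0 _ _) (hi 0%N 0%N)); apply; rewrite geo0 mulr1.
have hlu m n : abs_psum (fun i => l i - coor (u n) i) m <= 2 * C * geo n.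
  (* The coordinatewise rates [M i] need not be bounded in i, but only finitely many enter a partial
     sum, and their contribution vanishes as q grows. *)
  apply: (@le_geo _ _ _ (\sum_(i < m) `|M i|)) => q.
  have -> : abs_psum (fun i => l i - coor (u n) i) m =
      abs_psum (fun i => (l i - coor (u (q + n)%N) i) + d (q + n)%N n i) m.
    by congr abs_psum; apply/funext => i; rewrite /d subrKA.
  apply: le_trans (abs_psumD _ _ _) _; rewrite addrC lerD//.
    by apply: le_trans (hd _ _ _) _; rewrite gerBl !mulr_ge0// geo_ge0.
  rewrite mulr_suml; apply: ler_sum => i _; apply: le_trans (hM _ _) _.
  apply: (@le_trans _ _ (`|M i| * geo (q + n))).
    by rewrite ler_wpM2r ?geo_ge0 ?ler_norm.
  by rewrite ler_wpM2l// /geo exprD ler_piMr ?geo_le1// geo_ge0.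
have sl : abs_summable l.
  exists (2 * C * geo 0 + l1_norm (u 0%N)) => m.
  have -> : abs_psum l m = abs_psum (fun i => (l i - coor (u 0%N) i) + coor (u 0%N) i) m.
    by congr abs_psum; apply/funext => i; rewrite subrK.
  apply: le_trans (abs_psumD _ _ _) _.
  by rewrite lerD ?abs_psum_le_norm.
exists (l1_mk sl), (2 * C) => n; apply: l1_norm_le => m.
apply: le_trans (hlu m n); rewrite le_eqVlt; apply/orP; left; apply/eqP.
by congr abs_psum; apply/funext => i; rewrite coorD coorN.
Qed.

(** A sigma type, so that truncations and the diagonal operator can be defined by projection. *)
Lemma l1_dominated (x : l1) (y : nat -> k^o) C : 0 <= C ->
  (forall i, abs (y i) <= C * abs (coor x i)) ->
  {z : l1 | (forall i, coor z i = y i) /\ l1_norm z <= C * l1_norm x}.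
Proof.
move=> C0 hy; have hn n : abs_psum y n <= C * l1_norm x.
  apply: le_trans (_ : C * abs_psum (coor x) n <= _).
    by rewrite mulr_sumr; apply: ler_sum => i _.
  by rewrite ler_wpM2l// abs_psum_le_norm.
have sy : abs_summable y by exists (C * l1_norm x).
by exists (l1_mk sy); split=> //; apply: l1_norm_le.
Qed.

Let cut_ex (A : pred nat) (x : l1) :
  {z : l1 | (forall i, coor z i = if A i then coor x i else 0) /\
    l1_norm z <= 1 * l1_norm x}.
Proof.
apply: l1_dominated => // i; rewrite mul1r; case: (A i) => //.
by rewrite rabs0 rabs_ge0.
Qed.

Definition l1_cut A x : l1 := sval (cut_ex A x).

Lemma coor_cut A x i : coor (l1_cut A x) i = if A i then coor x i else 0.
Proof. by rewrite /l1_cut; case: cut_ex => z []. Qed.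

Lemma norm_cut A x : l1_norm (l1_cut A x) <= l1_norm x.
Proof. by rewrite /l1_cut; case: cut_ex => z [? /=]; rewrite mul1r. Qed.

Lemma cut_linear A : linear (l1_cut A).
Proof.
move=> a x y; apply: l1P => i; rewrite coorD coorZ !coor_cut coorD coorZ.
by case: (A i); rewrite ?mulr0 ?addr0.
Qed.

Lemma abs_psum_unit (i n : nat) : abs_psum (fun j => (i == j)%:R) n <= 1.
Proof.
rewrite /abs_psum; under eq_bigr do rewrite rabs_nat.
have [ni|ni] := leqP n i.
  by rewrite big1// => j _; rewrite gtn_eqF// (leq_trans (ltn_ord j)).
rewrite (bigD1 (Ordinal ni))//= eqxx big1 ?addr0// => j.
by rewrite -val_eqE eq_sym /= => /negbTE ->.
Qed.

Lemma unit_summable i : abs_summable (fun j => (i == j)%:R).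
Proof. by exists 1 => n; exact: abs_psum_unit. Qed.

Definition l1_unit i : l1 := l1_mk (unit_summable i).

Lemma coor_unit i j : coor (l1_unit i) j = (i == j)%:R.
Proof. by []. Qed.

Lemma norm_unit i : l1_norm (l1_unit i) <= 1.
Proof. by apply: l1_norm_le => n; exact: abs_psum_unit. Qed.

(** Once the first n terms carry all but e / 2 of the norm, the remaining ones contribute at most e
    / 2. *)
Lemma norm_tail (x : l1) e : 0 < e ->
  exists n, l1_norm (x - l1_cut (fun i => (i < n)%N) x) < e.
Proof.
move=> e0; have e2 : 0 < e / 2 by rewrite divr_gt0.
have [n hn] := l1_norm_approx x e2; exists n.
apply: (@le_lt_trans _ _ (e / 2)); last by rewrite ltr_pdivrMr// ltr_pMr// ltr1n.
apply: l1_norm_le => m; pose c := l1_cut (fun i => (i < n)%N) x.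
have mM : (m <= maxn m n)%N by rewrite leq_maxl.
have nM : (n <= maxn m n)%N by rewrite leq_maxr.
apply: le_trans (abs_psum_mono _ mM) _.
have h : abs_psum (coor (x - c)) (maxn m n) + abs_psum (coor c) (maxn m n)
    = abs_psum (coor x) (maxn m n).
  rewrite -big_split; apply: eq_bigr => i _ /=; rewrite coorD coorN coor_cut.
  by case: ifP => _; rewrite ?subrr ?rabs0 ?add0r// subr0 addr0.
have h1 : abs_psum (coor x) n = abs_psum (coor c) n.
  by apply: eq_bigr => i _; rewrite coor_cut ltn_ord.
have := abs_psum_mono (coor c) nM; rewrite -h1 => h2.
have := abs_psum_le_norm x (maxn m n); rewrite -h => h3.
by have := hn n (leqnn n); lra.
Qed.

(** Truncations of x are finite combinations of unit vectors, so [g] kills them, and they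
    approximate x. *)
Lemma l1_dense (X : tvsType k) (g : l1 -> X) : hausdorff_space X -> linear g ->
  ncont l1_norm g -> (forall i, g (l1_unit i) = 0) -> forall x, g x = 0.
Proof.
move=> hX gl gc gu x; apply: (hausdorff_eq0 hX) => U U0.
have [r r0 hr] := gc U U0; have [n hn] := norm_tail x r0.
have cut0 m : g (l1_cut (fun i => (i < m)%N) x) = 0.
  elim: m => [|m IH].
    by rewrite -[RHS](linear_fun0 gl); congr (g _); apply: l1P => i; rewrite coor_cut.
  have -> : l1_cut (fun i => (i < m.+1)%N) x =
      coor x m *: l1_unit m + l1_cut (fun i => (i < m)%N) x.
    apply: l1P => i; rewrite coorD coorZ !coor_cut coor_unit ltnS leq_eqVlt.
    have [<-|] := eqVneq m i; first by rewrite ltnn mulr1 addr0.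
    by rewrite mulr0 add0r.
  by rewrite gl IH gu scaler0 addr0.
have -> : g x = g (x - l1_cut (fun i => (i < n)%N) x).
  by rewrite (linear_funB _ _ gl) cut0 subr0.
exact: hr.
Qed.

End SummableSequences.

(** * A countable direct sum of copies of l^1, and the failure of left integrality *)

Section Counterexamples.
Variables (R : realType) (k : numFieldType) (rs : rscalars R k).
Local Notation abs := (rabs rs).
Local Notation emb := (remb rs).
Local Notation l1 := (l1 rs).
Local Notation norm1 := (@l1_norm _ _ rs).
Local Notation unit := (l1_unit rs).
Local Notation l1B := (l1_banach rs).
Local Notation l1LB := (banachLB l1B).

Definition sums_to (x : nat -> k) (s : k) := forall e : R, 0 < e ->
  exists n, forall m, (n <= m)%N -> abs (s - \sum_(i < m) x i) < e.

Lemma sums_to_ext x y s : (forall i, x i = y i) -> sums_to x s -> sums_to y s.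
Proof. by move=> /funext ->. Qed.

Lemma sums_to_unique x s t : sums_to x s -> sums_to x t -> s = t.
Proof.
move=> hs ht; apply/eqP; rewrite -subr_eq0; apply/eqP/(rabs_eq0 (rs := rs)).
apply/eqP; rewrite eq_le rabs_ge0 andbT; apply/ler_addgt0Pr => e e0; rewrite add0r.
have e2 : 0 < e / 2 by rewrite divr_gt0.
have [n hn] := hs _ e2; have [m hm] := ht _ e2.
have h1 := hn _ (leq_maxl n m); have h2 := hm _ (leq_maxr n m).
rewrite -(subrKA (\sum_(i < maxn n m) x i)).
apply: le_trans (rabsD _ _ _) _; rewrite -[X in _ + abs X]opprB rabsN.
by apply/ltW; lra.
Qed.

Lemma sums_to_lin a x y s t : sums_to x s -> sums_to y t ->
  sums_to (fun i => a * x i + y i) (a * s + t).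
Proof.
move=> hs ht e e0; have a0 : 0 < abs a + 1 by rewrite ltr_wpDl ?rabs_ge0.
have e1 : 0 < e / 2 / (abs a + 1) by rewrite !divr_gt0.
have e2 : 0 < e / 2 by rewrite divr_gt0.
have [n hn] := hs _ e1; have [m hm] := ht _ e2.
exists (maxn n m) => p; rewrite geq_max => /andP[/hn h1 /hm h2].
rewrite big_split -mulr_sumr opprD addrACA -mulrBr.
apply: le_lt_trans (rabsD _ _ _) _; rewrite rabsM.
move: h1; rewrite ltr_pdivlMr// mulrDr mulr1 => h1.
have := rabs_ge0 rs (s - \sum_(i < p) x i).
by rewrite mulrC; lra.
Qed.

(** Along indices [n j] at which the absolute sums are within [geo j] of the norm, the partial sums
    have increments at most [geo j] + [geo j.+1], so they converge geometrically. *)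
Lemma sums_to_ex (x : l1) : exists s, sums_to (coor x) s.
Proof.
have pd m p : abs (\sum_(i < p) coor x i - \sum_(i < m) coor x i) <=
    `|abs_psum rs (coor x) p - abs_psum rs (coor x) m|.
  wlog mp : m p / (m <= p)%N.
    move=> H; have [/H//|/ltnW/H] := leqP m p.
    by rewrite -rabsN opprB distrC.
  rewrite ger0_norm ?subr_ge0 ?abs_psum_mono//.
  rewrite -(subnK mp); elim: (p - m)%N => [|q IH]; first by rewrite !subrr rabs0.
  rewrite addSn big_ord_recr abs_psumS /=.
  rewrite addrAC; apply: le_trans (rabsD _ _ _) _.
  by rewrite [leRHS]addrAC lerD2r.
have [n hn] := choice (fun j => l1_norm_approx x (geo_gt0 R j)).
have close j p : (n j <= p)%N ->
    abs (\sum_(i < p) coor x i - \sum_(i < n j) coor x i) <= geo j.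
  move=> /hn h; apply: le_trans (pd _ _) _; rewrite ler_norml.
  have := hn j _ (leqnn (n j)).
  have := abs_psum_le_norm x (n j); have := abs_psum_le_norm x p.
  by move=> *; apply/andP; split; lra.
have [|l [M hl]] := @rabs_complete _ _ rs (fun j => \sum_(i < n j) coor x i) 2.
  move=> j; have h1 := close j _ (leq_maxl (n j) (n j.+1)).
  have h2 := close j.+1 _ (leq_maxr (n j) (n j.+1)).
  rewrite -(subrKA (\sum_(i < maxn (n j) (n j.+1)) coor x i)).
  apply: le_trans (rabsD _ _ _) _; rewrite -[X in abs X + _]opprB rabsN.
  by move: h2; rewrite geoS; have := geo_gt0 R j; lra.
exists l => e e0; have [j hj] := geo_small (M + 1) e0; exists (n j) => p pj.
rewrite -(subrKA (\sum_(i < n j) coor x i)).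
apply: le_lt_trans (rabsD _ _ _) _; rewrite -[X in _ + abs X]opprB rabsN.
apply: le_lt_trans (hj j (leqnn j)); rewrite mulrDl mul1r.
by rewrite lerD ?hl ?close.
Qed.

Lemma sums_to_le (x : l1) s : sums_to (coor x) s -> abs s <= norm1 x.
Proof.
move=> hs; apply/ler_addgt0Pr => e /hs[n /(_ n (leqnn n)) h].
rewrite -(subrK (\sum_(i < n) coor x i) s); apply: le_trans (rabsD _ _ _) _.
rewrite addrC lerD ?(ltW h)//; apply: le_trans (abs_psum_le_norm x n).
rewrite /abs_psum; elim: n {h} => [|n IH]; first by rewrite !big_ord0 rabs0.
by rewrite !big_ord_recr /=; apply: le_trans (rabsD _ _ _) _; rewrite lerD2r.
Qed.

Lemma sums_to_single (c : k) j x : (forall i, x i = if j == i then c else 0) ->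
  sums_to x c.
Proof.
move=> hx e e0; exists j.+1 => m jm.
rewrite (bigD1 (Ordinal jm))//= hx eqxx big1 ?addr0 ?subrr ?rabs0// => i.
by rewrite hx -val_eqE eq_sym /= => /negbTE ->.
Qed.

(* The blocks of coordinates [level i = n] are infinite, so [levelLB] below is a
   countable direct sum of copies of [l1]. *)
Definition level (i : nat) := logn 2 i.+1.

(** The level of i is the 2-adic valuation of i + 1; take i + 1 = 2^n (2m + 1). *)
Lemma level_unbounded n m : exists2 i, level i = n & (m <= i)%N.
Proof.
exists (2 ^ n * (m.*2.+1)).-1.
  rewrite /level prednK ?muln_gt0 ?expn_gt0//.
  rewrite lognM ?expn_gt0// pfactorK// [X in (_ + X)%N](_ : _ = 0%N) ?addn0//.
  by rewrite logn_coprime// coprime2n /= odd_double.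
rewrite -ltnS prednK ?muln_gt0 ?expn_gt0//.
apply: leq_trans (leq_pmull _ _); last by rewrite expn_gt0.
by rewrite ltnS -addnn leq_addr.
Qed.

Let finite_level : set l1 :=
  [set x | exists n, forall i, (n <= level i)%N -> coor x i = 0].

Let finite_level_lsubspace : lsubspace finite_level.
Proof.
split; first by exists 0%N.
move=> a x y [n hn] [m hm]; exists (maxn n m) => i.
rewrite geq_max => /andP[/hn xi /hm yi].
by rewrite coorD coorZ xi yi mulr0 addr0.
Qed.

Definition levelT : lmodType k := subT finite_level_lsubspace.
Definition level_incl (x : levelT) : l1 := subT_val x.

Let below n : pred nat := fun i => (level i < n)%N.

Let cut_below n (x : l1) : finite_level (l1_cut (below n) x).
Proof.
by exists n => i ni; rewrite coor_cut /below ltnNge ni.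
Qed.

(** Each step is all of l^1, mapped non-injectively by truncation to the levels below n; this saves
    introducing the subspaces supported there. *)
Definition level_step n (x : l1) : levelT :=
  subT_mk finite_level_lsubspace (cut_below n x).

Let level_step_linear n : linear (@level_step n).
Proof. by move=> a x y; apply: subT_inj; exact: cut_linear. Qed.

Let level_cover (y : levelT) : exists n x, mklin (@level_step_linear n) x = y.
Proof.
have [n hn] := subTP y; exists n, (level_incl y); apply: subT_inj; apply: l1P => i.
by rewrite coor_cut /below; case: ltnP => // /hn ->.
Qed.

Let level_nested n : exists C : R, forall x : l1, exists x' : l1,
  mklin (@level_step_linear n.+1) x' = mklin (@level_step_linear n) x /\
  norm1 x' <= C * norm1 x.
Proof.
exists 1 => x; exists (l1_cut (below n) x); rewrite mul1r norm_cut; split=> //.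
apply: subT_inj; apply: l1P => i; rewrite !coor_cut /below.
by case: (ltnP (level i) n) => [/ltnW h|_]; rewrite ?ltnS ?h//; case: ifP.
Qed.

Definition level_pres : pres rs levelT :=
  @Pres R k rs levelT (fun=> l1) (fun=> norm1) (fun=> l1B)
    (fun n => mklin (@level_step_linear n)) level_cover level_nested.

Lemma level_incl_linear : linear level_incl.
Proof. by []. Qed.

Lemma level_incl_inj : injective level_incl.
Proof. exact: subT_inj. Qed.

Let incl_step n : ncont norm1 (level_incl \o level_step n : l1 -> l1LB).
Proof.
apply: (@ncont_banachLB _ _ _ _ _ l1B _ _ (level_incl \o level_step n) 1 ler01).
by move=> x; rewrite mul1r norm_cut.
Qed.

Let level_sep : point_separated level_pres.
Proof.
move=> v v0; exists l1LB, level_incl; split.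
- exact: LB_hausdorff.
- by [].
- exact: incl_step.
- by move=> h; apply: v0; apply: level_incl_inj.
Qed.

Definition levelLB : LBspace k := mkLB level_sep.

Lemma levelLB_continuous (B : tvsType k) (h : levelT -> B) : linear h ->
  (forall n, ncont norm1 (h \o level_step n)) -> continuous (h : levelLB -> B).
Proof.
by move=> hl hc; apply: (pres_continuous (P := fin_pres level_pres)
  (@fin_presents _ _ _ _ _) hl).
Qed.

Lemma levelLB_ncont (B : tvsType k) (h : lcfun levelLB B) n :
  ncont norm1 ((h : levelT -> B) \o level_step n).
Proof.
apply: (@pres_ncont _ _ _ _ (fin_pres level_pres) _ h (@fin_presents _ _ _ _ _) _ _ n).
  exact: lcfun_linear.
exact: lcfun_continuous.
Qed.

Lemma level_unitP i : finite_level (unit i).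
Proof.
exists (level i).+1 => j; rewrite coor_unit.
by have [<-|//] := eqVneq i j; rewrite ltnn.
Qed.

Definition level_unit i : levelT := subT_mk finite_level_lsubspace (level_unitP i).

(* [phi x] is the sum of all [level i * x i]: continuous on each step of
   [levelLB], unbounded for the norm of [l1]. *)
Let weighted_ex (x : levelT) :
  {s : k | sums_to (fun i => (level i)%:R * coor (level_incl x) i) s}.
Proof.
apply: cid; have [n hn] := subTP x.
have [|z [hz _]] := @l1_dominated _ _ rs (level_incl x)
    (fun i => (level i)%:R * coor (level_incl x) i) n%:R (ler0n _ _).
  move=> i; rewrite rabsM rabs_nat; have [ni|ni] := leqP n (level i).
    by rewrite [coor _ _]hn// rabs0 !mulr0.
  by rewrite ler_wpM2r ?rabs_ge0// ler_nat ltnW.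
by have [s hs] := sums_to_ex z; exists s; exact: sums_to_ext hz hs.
Qed.

Definition phi (x : levelT) : k^o := sval (weighted_ex x).

Lemma phiP x : sums_to (fun i => (level i)%:R * coor (level_incl x) i) (phi x).
Proof. by rewrite /phi; case: weighted_ex. Qed.

Lemma phi_unique x s :
  sums_to (fun i => (level i)%:R * coor (level_incl x) i) s -> phi x = s.
Proof. exact: sums_to_unique (phiP x). Qed.

Lemma phi_linear : linear phi.
Proof.
move=> a x y; apply: phi_unique.
apply: sums_to_ext (sums_to_lin a (phiP x) (phiP y)) => i.
by rewrite level_incl_linear coorD coorZ mulrCA -mulrDr.
Qed.

Lemma phi_unit i : phi (level_unit i) = (level i)%:R.
Proof.
apply: phi_unique; apply: (@sums_to_single _ i) => j.
rewrite [coor _ _]coor_unit.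
by have [->|_] := eqVneq i j; rewrite ?mulr1 ?mulr0.
Qed.

(** On step n the weights are below n, so [phi] is bounded there by n times the norm. *)
Let phi_ncont n : ncont norm1 (phi \o level_step n : l1 -> scalarLB rs).
Proof.
apply: (@ncont_banachLB _ _ _ _ _ (scalar_banach rs) _ _ (phi \o level_step n) n%:R
  (ler0n _ _)) => x.
have [|z [hz Nz]] := @l1_dominated _ _ rs x
    (fun i => (level i)%:R * coor (l1_cut (below n) x) i) n%:R (ler0n _ _).
  move=> i; rewrite rabsM rabs_nat coor_cut /below.
  case: ltnP => [ni|_]; last by rewrite rabs0 mulr0 mulr_ge0 ?rabs_ge0.
  by rewrite ler_wpM2r ?rabs_ge0// ler_nat ltnW.
apply: le_trans Nz; apply: sums_to_le.
exact: sums_to_ext (fun i => esym (hz i)) (phiP (level_step n x)).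
Qed.

Definition phi_mor : lcfun levelLB (scalarLB rs) :=
  mkmor (A := levelLB) (B := scalarLB rs) phi_linear
    (@levelLB_continuous (scalarLB rs) phi phi_linear phi_ncont).

Let diag_ex (x : l1) : {z : l1 | (forall i, coor z i = emb (geo i) * coor x i) /\
  norm1 z <= 1 * norm1 x}.
Proof.
apply: l1_dominated => // i; rewrite rabsM rabs_emb ?geo_ge0//.
by rewrite ler_wpM2r ?rabs_ge0 ?geo_le1.
Qed.

(** The operator T = diag(2^-i). *)
Definition diag (x : l1) : l1 := sval (diag_ex x).

Lemma coor_diag x i : coor (diag x) i = emb (geo i) * coor x i.
Proof. by rewrite /diag; case: diag_ex => z []. Qed.

Lemma norm_diag x : norm1 (diag x) <= 1 * norm1 x.
Proof. by rewrite /diag; case: diag_ex => z []. Qed.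

Lemma diag_linear : linear diag.
Proof.
move=> a x y; apply: l1P => i.
by rewrite coorD coorZ !coor_diag coorD coorZ mulrDr mulrCA.
Qed.

Lemma geo_neq0 i : emb (geo i) != 0.
Proof. by rewrite gt_eqF// -(rmorph0 emb) remb_lt geo_gt0. Qed.

Lemma diag_eq0 x i : coor (diag x) i = 0 -> coor x i = 0.
Proof.
by rewrite coor_diag => /eqP; rewrite mulf_eq0 (negbTE (geo_neq0 i)) => /eqP.
Qed.

Lemma diag_unit i : diag (unit i) = emb (geo i) *: unit i.
Proof.
apply: l1P => j; rewrite coor_diag coorZ coor_unit.
by have [->|] := eqVneq i j; rewrite ?mulr0.
Qed.

Definition diag_mor : lcfun l1LB l1LB :=
  mkmor (A := l1LB) (B := l1LB) diag_linear
    (@banachLB_continuous _ _ _ _ _ l1B l1LB diag diag_linear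
      (@ncont_banachLB _ _ _ _ _ l1B _ _ diag 1 ler01 norm_diag)).

(** Morphisms agreeing after T agree on T e_i = 2^-i e_i, hence on all unit vectors, whose span is
    dense. *)
Lemma diag_epi : epimorphism (C := LB k) (diag_mor : @mor (LB k) l1LB l1LB).
Proof.
move=> X g h gh; apply: lcfun_ext => x.
pose d := (g : lcfun l1LB X) - (h : lcfun l1LB X).
suff : (d : l1 -> X) x = 0 by move=> /eqP; rewrite subr_eq0 => /eqP.
apply: (l1_dense (rs := rs) (@LB_hausdorff k X) (lcfun_linear d)).
  exact: banachLB_ncont.
move=> i; apply/eqP.
have := linear_funZ (emb (geo i)) (unit i : l1LB) (lcfun_linear d).
have -> : d (emb (geo i) *: (unit i : l1LB)) = 0.
  rewrite -[_ *: _]diag_unit; apply/eqP; rewrite subr_eq0; apply/eqP.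
  exact: (congr1 (fun u : lcfun l1LB X => u (unit i)) gh).
by move/esym/eqP; rewrite scaler_eq0 (negbTE (geo_neq0 i)).
Qed.

Lemma LB_not_left_integral : ~ left_integral (LB k).
Proof.
move=> [_ stable]; have [Z Z0] := LB_zero rs.
(* The line is spanned by (2^-i), whose preimage under T would be the constant sequence 1, which is
   not summable. *)
have sg : abs_summable rs (fun i => emb (geo i) : k^o).
  exists 2 => n; have -> : abs_psum rs (fun i => emb (geo i)) n = \sum_(i < n) geo i.
    by apply: eq_bigr => i _; rewrite rabs_emb ?geo_ge0.
  suff -> : \sum_(i < n) geo i = 2 - 2 * geo n :> R.
    by rewrite gerBl mulr_ge0 ?geo_ge0.
  elim: n => [|n IH]; first by rewrite big_ord0 geo0; lra.
  by rewrite big_ord_recr /= IH geoS; lra.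
have [c hc] := scalarLB_point rs (l1_mk sg : l1LB).
pose a : lcfun (Z : LBspace k) (scalarLB rs) := 0.
pose b : lcfun (Z : LBspace k) l1LB := 0.
(* The zero corner is a pullback: c (x t) = T (y t) makes every coordinate of y t equal to x t, and
   a constant summable sequence vanishes. *)
have sq : pullback_square (C := LB k) (a : @mor (LB k) Z (scalarLB rs))
    (b : @mor (LB k) Z l1LB) (c : @mor (LB k) (scalarLB rs) l1LB)
    (diag_mor : @mor (LB k) l1LB l1LB).
  split.
    apply: lcfun_ext => z; rewrite /= (linear_fun0 (lcfun_linear c)).
    by rewrite -[LHS](linear_fun0 diag_linear).
  move=> X x y cxy.
  have key t : ((x : lcfun X (scalarLB rs)) t : k) = 0 /\
      ((y : lcfun X l1LB) t : l1) = 0.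
    have h := congr1 (fun u : lcfun X l1LB => u t) cxy.
    rewrite /= hc in h.
    have hi i : coor ((y : lcfun X l1LB) t : l1) i = (x : lcfun X (scalarLB rs)) t :> k.
      have := congr1 (fun u : l1 => coor u i) h; rewrite coor_diag coorZ mulrC.
      by move=> /(mulfI (geo_neq0 i)).
    have x0 : ((x : lcfun X (scalarLB rs)) t : k) = 0.
      apply: (rabs_eq0 (rs := rs)); apply/eqP; rewrite eq_le rabs_ge0 andbT.
      rewrite leNgt; apply/negP => x0.
      set xt : k := (x : lcfun X (scalarLB rs)) t in hi x0.
      set yt : l1 := (y : lcfun X l1LB) t in hi.
      (* By the Archimedean property, that many equal coordinates already exceed the norm. *)
      have := abs_psum_le_norm yt (Num.bound (norm1 yt / abs xt)).
      have -> : abs_psum rs (coor yt) (Num.bound (norm1 yt / abs xt)) =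
          abs xt *+ Num.bound (norm1 yt / abs xt).
        rewrite /abs_psum (eq_bigr (fun=> abs xt)) => [|i _]; last by rewrite hi.
        by rewrite sumr_const card_ord.
      apply/negP; rewrite -ltNge -mulr_natl -ltr_pdivrMr//.
      by apply: archi_boundP; rewrite divr_ge0 ?(normB_ge0 l1B) ?rabs_ge0.
    by split=> //; apply: l1P => i; rewrite hi x0.
  exists (0 : lcfun (X : LBspace k) (Z : LBspace k)); split.
    split; apply: lcfun_ext => t.
      exact: (esym (key t).1).
    exact: (esym (key t).2).
  move=> h _; have [[h0 [_ hu]] _] := Z0 X.
  by rewrite -(hu 0)// -(hu h).
have epi := stable _ _ _ _ _ _ _ _ sq diag_epi.
(* An epimorphism from the zero object identifies the identity of the scalars with 0. *)
have : (lcfun_id (scalarLB rs)) = 0 :> lcfun (scalarLB rs) (scalarLB rs).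
  by apply: epi; apply: lcfun_ext => z.
move=> /(congr1 (fun u : lcfun (scalarLB rs) (scalarLB rs) => (u (1 : k) : k))).
by move=> /eqP; rewrite oner_eq0.
Qed.

End Counterexamples.

Lemma mcomp0l (C : preadditive) (A B D : C) (f : mor A B) :
  mcomp (0 : mor B D) f = 0.
Proof.
by apply: (addrI (mcomp 0 f)); rewrite -compDl !addr0.
Qed.

(** * Failure of right semi-abelianity *)

Section NotRightSemiAbelian.
Variables (R : realType) (k : numFieldType) (rs : rscalars R k).
Local Notation abs := (rabs rs).
Local Notation emb := (remb rs).
Local Notation l1 := (l1 rs).
Local Notation norm1 := (@l1_norm _ _ rs).
Local Notation unit := (l1_unit rs).
Local Notation l1B := (l1_banach rs).
Local Notation l1LB := (banachLB l1B).
Local Notation levelLB := (levelLB rs).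

Lemma level_incl_ncont n : ncont norm1 (@level_incl _ _ rs \o level_step n : l1 -> l1LB).
Proof.
apply: (@ncont_banachLB _ _ _ _ _ l1B _ _ (@level_incl _ _ rs \o level_step n) 1 ler01).
by move=> x; rewrite mul1r norm_cut.
Qed.

Definition incl_mor : lcfun levelLB l1LB :=
  mkmor (A := levelLB) (B := l1LB) (@level_incl_linear _ _ rs)
    (@levelLB_continuous _ _ rs l1LB (@level_incl _ _ rs) (@level_incl_linear _ _ rs)
      level_incl_ncont).

(* By the closed graph theorem, a morphism into [l1] whose values have finite
   level is a morphism into [levelLB]. *)
Lemma level_lift (X : LBspace k) (g : lcfun X l1LB) (h : X -> levelT rs) :
  (forall x, level_incl (h x) = g x) ->
  exists r : lcfun X levelLB, forall x, r x = h x.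
Proof.
move=> hg; have [P hP] := LB_presents rs X.
have hl : linear (h : X -> levelLB).
  move=> a x y; apply: level_incl_inj.
  by rewrite hg (lcfun_linear g) level_incl_linear !hg.
have hc : continuous (h : X -> levelLB).
  apply: (pres_continuous hP hl) => n.
  apply: (@ncont_factor _ _ rs _ (level_pres rs) l1LB (@level_incl _ _ rs) _ _
    (g \o step_map P n) (h \o step_map P n)).
  - exact: LB_hausdorff.
  - exact: level_incl_linear.
  - exact: level_incl_inj.
  - exact: level_incl_ncont.
  - exact: step_banach.
  - by move=> a x y; rewrite /= linearP (lcfun_linear g).
  - by apply: (pres_ncont hP); [exact: lcfun_linear|exact: lcfun_continuous].
  - by move=> t; exact: hg.
by exists (mkmor hl hc).
Qed.

Lemma diag_level (x : levelT rs) : exists y : levelT rs,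
  level_incl y = diag (level_incl x).
Proof.
have [n hn] := subTP x.
have fl : exists n, forall i, (n <= level i)%N -> coor (diag (level_incl x)) i = 0.
  by exists n => i /hn h; rewrite coor_diag [coor _ _]h mulr0.
by exists (subT_mk _ fl).
Qed.

(** T preserves finiteness of the level, and its restriction is continuous by [level_lift]. *)
Lemma level_diag_ex : exists t : lcfun levelLB levelLB,
  forall x, level_incl (t x : levelT rs) = diag (level_incl (x : levelT rs)).
Proof.
have [h hh] := choice diag_level.
have [r hr] := @level_lift levelLB (lcfun_comp (diag_mor rs) incl_mor) h hh.
by exists r => x; rewrite hr.
Qed.

(** For e_i of level n, w = g1 (e_i / n) + g2 (2^-i e_i / n). The first term is small for large n
    uniformly in i, the e_i being bounded in l^1; the second is small for large i with n fixed, as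
    only one step is involved. *)
Lemma phi_vector_eq0 (X : LBspace k) (w : X) (g1 : lcfun l1LB X)
    (g2 : lcfun levelLB X) :
  (forall i, g1 (unit i) + emb (geo i) *: g2 (level_unit rs i) = (level i)%:R *: w) ->
  w = 0.
Proof.
move=> hw; apply: (hausdorff_eq0 (@LB_hausdorff k X)) => U /nbhs0_half[W W0 WU].
have [r r0 hr] := @banachLB_ncont _ _ _ _ _ l1B X g1 _ W0.
(* The successor ensures that n is nonzero and 1 / n < r. *)
pose n := (Num.bound r^-1).+1.
have n0 : 0 < n%:R :> R by rewrite ltr0n.
have nV : 0 <= (n%:R : R)^-1 by rewrite invr_ge0 ltW.
(* Step n keeps only levels strictly below n, so unit vectors of level n need step n + 1. *)
have [r2 r20 hr2] := @levelLB_ncont _ _ rs X g2 n.+1 _ W0.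
have [m hm] := geo_small 1 r20.
have [i li mi] := level_unbounded n m.
have nk : n%:R != 0 :> k by rewrite pnatr_eq0.
have -> : w = g1 ((n%:R : k)^-1 *: (unit i : l1LB)) +
    g2 (((n%:R : k)^-1 * emb (geo i)) *: (level_unit rs i : levelLB)).
  rewrite (linear_funZ _ _ (lcfun_linear g1)) (linear_funZ _ _ (lcfun_linear g2)).
  by rewrite -scalerA -scalerDr hw li scalerA mulVf// scale1r.
have absV : abs (n%:R)^-1 = n%:R^-1 by rewrite rabsV rabs_nat.
apply: WU.
  apply: hr; rewrite (normB_Z l1B) absV.
  apply: le_lt_trans (_ : n%:R^-1 < r).
    by rewrite ler_piMr ?norm_unit.
  rewrite invf_plt ?posrE//; apply: lt_trans (_ : (Num.bound r^-1)%:R < _).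
    by apply: archi_boundP; rewrite invr_ge0 ltW.
  by rewrite ltr_nat.
have e : level_step n.+1 (((n%:R : k)^-1 * emb (geo i)) *: unit i) =
    ((n%:R : k)^-1 * emb (geo i)) *: level_unit rs i.
  apply: level_incl_inj; apply: l1P => j.
  rewrite coor_cut [in RHS]/level_incl !coorZ coor_unit.
  have [<-|_] := eqVneq i j; first by rewrite li ltnSn.
  by rewrite mulr0; case: ifP.
have := hr2 (((n%:R : k)^-1 * emb (geo i)) *: unit i); rewrite /= e; apply.
rewrite (normB_Z l1B) rabsM absV rabs_emb ?geo_ge0//.
apply: le_lt_trans (hm i mi); rewrite mul1r.
rewrite mulrAC ler_piMl ?geo_ge0// mulr_ile1// ?norm_unit ?(normB_ge0 l1B)//.
by rewrite invf_le1// ler1n.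
Qed.

Lemma LB_not_right_semi_abelian : ~ right_semi_abelian (LB k).
Proof.
move=> [_ factorization].
have [PF hPF] := LB_presents rs levelLB; have [Pl hPl] := LB_presents rs l1LB.
have [B [iA [iB [pA [pB [pAiA pBiB pAiB pBiA idB]]]]]] := LB_biproduct_ex hPl hPF.
have [t ht] := level_diag_ex.
pose T : @mor (LB k) l1LB l1LB := diag_mor rs.
pose inc : @mor (LB k) levelLB l1LB := incl_mor.
pose td : @mor (LB k) levelLB levelLB := t.
pose ph : @mor (LB k) levelLB (scalarLB rs) := phi_mor rs.
have Tinc : mcomp T inc = mcomp inc td by apply: lcfun_ext => x; rewrite /= ht.
have inc_mono (X : LB k) (u v : mor X levelLB) : mcomp inc u = mcomp inc v -> u = v.
  move=> uv; apply: lcfun_ext => x; apply: level_incl_inj.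
  exact: (congr1 (fun w : lcfun X l1LB => w x) uv).
pose j : @mor (LB k) levelLB B := mcomp iA inc + mcomp iB td.
have pAj : mcomp pA j = inc.
  by rewrite compDr !Defs.compA pAiA pAiB comp1m mcomp0l addr0.
have pBj : mcomp pB j = td.
  by rewrite compDr !Defs.compA pBiA pBiB comp1m mcomp0l add0r.
(* Here [iota] is the inclusion of ker phi; the factorization to be refuted is that of [j]
   restricted to it. *)
have [A [iota [phiota iotaU]]] := LB_kernel (phi_mor rs) hPF.
have [I [i [p [f_ip [X [g [gi iU]]] pepi]]]] := factorization _ _ (mcomp j iota).
(* The relation T x = y, valid on the range of [j], extends to all of [I] because [p] is an
   epimorphism. *)
have Ti : mcomp T (mcomp pA i) = mcomp inc (mcomp pB i).
  apply: pepi; rewrite -!Defs.compA -f_ip.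
  by rewrite (Defs.compA pA) (Defs.compA pB) pAj pBj !Defs.compA Tinc.
(* By this relation T maps the first component of [i] to a vector of finite level. As T only
   rescales coordinates by nonzero factors, that component has finite level too, and [level_lift]
   applies. *)
have [r hr] : exists r : mor I levelLB, mcomp inc r = mcomp pA i.
  have ex (x : (I : LBspace k)) : exists y : levelT rs,
      level_incl y = (mcomp pA i : lcfun I l1LB) x.
    have hx := congr1 (fun u : lcfun I l1LB => u x) Ti.
    pose z : levelT rs := (mcomp pB i : lcfun I levelLB) x.
    have [n hn] := subTP z.
    have fl : exists n, forall l, (n <= level l)%N ->
        coor ((mcomp pA i : lcfun I l1LB) x) l = 0.
      exists n => l /hn h; apply: diag_eq0; rewrite -h.
      exact: (congr1 (fun u : l1 => coor u l) hx).
    by exists (subT_mk _ fl).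
  have [h hh] := choice ex.
  have [r rh] := level_lift hh.
  by exists r; apply: lcfun_ext => x; rewrite -hh -rh.
have jr : mcomp j r = i.
  have tr : mcomp td r = mcomp pB i.
    by apply: inc_mono; rewrite Defs.compA -Tinc -Defs.compA hr Ti.
  by rewrite compDl -!Defs.compA hr tr !Defs.compA -compDl idB comp1m.
have rp : mcomp r p = iota.
  apply: inc_mono; rewrite Defs.compA hr -Defs.compA -f_ip.
  by rewrite Defs.compA pAj.
(* Since phi vanishes on r p = iota and [p] is an epimorphism, [r] takes its values in ker phi. *)
have phr : mcomp ph r = 0.
  by apply: pepi; rewrite -Defs.compA rp mcomp0l; exact: phiota.
(* The map g j kills ker phi, so it is phi times its value [w] at a vector where phi is 1, such as a
   unit vector of level 1. *)
pose gam : @mor (LB k) levelLB X := mcomp g j.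
have gam_iota : mcomp gam iota = 0.
  by rewrite -Defs.compA f_ip Defs.compA gi mcomp0l.
have [i1 li1 _] := level_unbounded 1 0.
pose e1 : levelLB := level_unit rs i1.
have phe1 : phi e1 = 1 :> k by rewrite phi_unit li1.
pose w := (gam : lcfun levelLB X) e1.
have gamE y : (gam : lcfun levelLB X) y = (phi y : k) *: w.
  pose y0 : levelLB := y - (phi y : k) *: e1.
  have y00 : (phi_mor rs) y0 = 0.
    rewrite (linear_funB _ _ (lcfun_linear _)) (linear_funZ _ _ (lcfun_linear _)).
    apply/eqP; rewrite subr_eq0; apply/eqP.
    by have : (phi y : k) = phi y * phi e1 by rewrite phe1 mulr1.
  have [q hq] := scalarLB_point rs y0.
  have [|h [ih _]] := iotaU (scalarLB rs) q.
    apply: lcfun_ext => c; rewrite /= hq.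
    by rewrite [LHS](linear_funZ _ _ (lcfun_linear (phi_mor rs))) y00 scaler0.
  have gy0 : (gam : lcfun levelLB X) y0 = 0.
    have <- : (q : lcfun (scalarLB rs) levelLB) 1 = y0 by rewrite hq scale1r.
    rewrite -ih.
    exact: (congr1 (fun u : lcfun A X => u ((h : lcfun (scalarLB rs) A) 1)) gam_iota).
  apply/eqP; rewrite -subr_eq0 -gy0 (linear_funB _ _ (lcfun_linear _)).
  by rewrite (linear_funZ _ _ (lcfun_linear _)).
have w0 : w = 0.
  apply: (@phi_vector_eq0 X w (mcomp g iA : lcfun l1LB X) (mcomp g iB : lcfun levelLB X)).
  move=> l; rewrite -(@phi_unit _ _ rs l) -gamE.
  have -> : gam = mcomp (mcomp g iA) inc + mcomp (mcomp g iB) td.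
    by rewrite /gam compDr !Defs.compA.
  rewrite -[_ *: _](linear_funZ _ _ (lcfun_linear (mcomp g iB : lcfun levelLB X))).
  have -> : emb (geo l) *: (level_unit rs l : levelLB) = t (level_unit rs l) by
    apply: level_incl_inj; rewrite ht diag_unit.
  by [].
have gj0 : mcomp g j = 0.
  by apply: lcfun_ext => y; rewrite [LHS]gamE w0 scaler0.
(* As [i] is a kernel of [g], j = i h. Then r h is the identity, and phi r = 0 forces phi = 0. *)
have [h [ih _]] := iU _ _ gj0.
have rh : mcomp r h = idmor _.
  by apply: inc_mono; rewrite Defs.compA hr -Defs.compA ih pAj compm1.
have : mcomp ph (mcomp r h) = 0 by rewrite Defs.compA phr mcomp0l.
rewrite rh compm1 => /(congr1 (fun u : lcfun levelLB (scalarLB rs) => (u e1 : k))).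
by move=> /eqP; rewrite [X in X == _]phe1 oner_eq0.
Qed.

End NotRightSemiAbelian.

(** * Real and complex scalars *)

Section RealScalars.
Variable R : realType.

(** The intervals of radius 2 C [geo n] around [u n] are nested, so the supremum of their left ends
    lies in all of them. *)
Lemma real_fast_complete (u : nat -> R) (C : R) :
  (forall n, `|u n.+1 - u n| <= C * geo n) ->
  exists l M, forall n, `|l - u n| <= M * geo n.
Proof.
move=> hu; pose a n := u n - 2 * C * geo n; pose b n := u n + 2 * C * geo n.
have C0 : 0 <= C by have := le_trans (normr_ge0 _) (hu 0%N); rewrite geo0 mulr1.
have aS : {homo a : m n / (m <= n)%N >-> m <= n}.
  apply: homo_leq => [x|y x z|n]; [exact: lexx|exact: le_trans|].
  by have := hu n; rewrite /a geoS ler_norml => /andP[]; lra.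
have bS : {homo b : m n / (m <= n)%N >-> n <= m}.
  apply: homo_leq => [x|y x z /[swap]|n]; [exact: lexx|exact: le_trans|].
  by have := hu n; rewrite /b geoS ler_norml => /andP[]; lra.
have ab n m : a n <= b m.
  apply: le_trans (aS _ _ (leq_maxl n m)) _.
  apply: le_trans _ (bS _ _ (leq_maxr n m)).
  rewrite /a /b lerD2l; apply: (@le_trans _ _ 0).
    by rewrite oppr_le0 !mulr_ge0 ?geo_ge0.
  by rewrite !mulr_ge0 ?geo_ge0.
have hs : has_sup [set a n | n in setT].
  by split; [exists (a 0%N), 0%N|exists (b 0%N) => _ [n _ <-]].
exists (sup [set a n | n in setT]), (2 * C) => n.
have h1 : a n <= sup [set a n | n in setT].
  by apply: sup_upper_bound hs _ _; exists n.
have h2 : sup [set a n | n in setT] <= b n.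
  by apply: ge_sup; [case: hs|move=> _ [m _ <-]].
by rewrite ler_norml; apply/andP; move: h1 h2; rewrite /a /b; split; lra.
Qed.

Lemma real_rscalars : rscalars R R.
Proof.
exact: (@RScalars R R (@idfun R) (fun x => `|x|) (fun=> erefl) (fun _ _ => erefl)
  real_fast_complete).
Qed.

Local Open Scope complex_scope.

Let cabs (z : R[i]) : R := Num.sqrt (complex.Re z ^+ 2 + complex.Im z ^+ 2).

Let cabs_Re z : `|complex.Re z| <= cabs z.
Proof. by rewrite -sqrtr_sqr ler_wsqrtr// lerDl sqr_ge0. Qed.

Let cabs_Im z : `|complex.Im z| <= cabs z.
Proof. by rewrite -sqrtr_sqr ler_wsqrtr// lerDr sqr_ge0. Qed.

Let cabs_le z : cabs z <= `|complex.Re z| + `|complex.Im z|.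
Proof.
rewrite -[leRHS]ger0_norm ?addr_ge0// -sqrtr_sqr ler_wsqrtr// sqrrD !real_normK ?num_real//.
by rewrite addrAC lerDl mulrn_wge0// mulr_ge0.
Qed.

Let complex_fast_complete (u : nat -> R[i]) (C : R) :
  (forall n, cabs (u n.+1 - u n) <= C * geo n) ->
  exists l M, forall n, cabs (l - u n) <= M * geo n.
Proof.
move=> hu.
have [|x [M hx]] := @real_fast_complete (fun n => complex.Re (u n)) C.
  by move=> n; apply: le_trans (hu n); rewrite -raddfB cabs_Re.
have [|y [M' hy]] := @real_fast_complete (fun n => complex.Im (u n)) C.
  by move=> n; apply: le_trans (hu n); rewrite -raddfB cabs_Im.
exists (x +i* y), (M + M') => n; apply: le_trans (cabs_le _) _.
by rewrite mulrDl !raddfB; apply: lerD; [exact: hx|exact: hy].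
Qed.

Lemma complex_rscalars : rscalars R (R[i] : numFieldType).
Proof.
exact: (@RScalars R R[i] (real_complex R) cabs (fun z => esym (normc_def z)) (@lecR R)
  complex_fast_complete).
Qed.

End RealScalars.

Local Open Scope complex_scope.

Theorem theorem3p4 (R : realType) (k : numFieldType)
  (hk : k = (R : numFieldType) \/ k = (R[i] : numFieldType)) :
  left_quasi_abelian (LB k) /\
  ~ right_semi_abelian (LB k) /\
  ~ left_integral (LB k).
Proof.
have [rs] : inhabited (rscalars R k).
  by case: hk => ->; [exists; exact: real_rscalars|exists; exact: complex_rscalars].
split; first exact: LB_left_quasi_abelian rs.
split; [exact: (LB_not_right_semi_abelian rs)|exact: (LB_not_left_integral rs)].
Qed.
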